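(* Let $m,n\geq 1$ be integers with $d=m+n\geq 3$ and let $\Theta$ be a real $n\times m$ matrix. For each $p=1,\ldots,d-2$ the following statements hold. If $p\geq m$, then \[ (d-p-1)(1+\mathfrak b_{p+1})\geq(d-p)(1+\mathfrak b_p),\qquad (d-p-1)(1+\mathfrak a_{p+1})\geq(d-p)(1+\mathfrak a_p). \] If $p\leq m-1$, then \[ (d-p-1)(1+\mathfrak b_p)^{-1}\geq(d-p)(1+\mathfrak b_{p+1})^{-1}-n,\qquad (d-p-1)(1+\mathfrak a_p)^{-1}\geq(d-p)(1+\mathfrak a_{p+1})^{-1}-n. \]
   Context: Let $\vec e_1,\ldots,\vec e_d$ be the standard basis of $\mathbb R^d$ and let $\boldsymbol\ell_1,\ldots,\boldsymbol\ell_d$ be the columns of the $d\times d$ matrix $\begin{pmatrix}E_m&-{}^t\Theta\\ \Theta&E_n\end{pmatrix}$, where $E_k$ denotes the $k\times k$ identity matrix and ${}^t\Theta$ the transpose. For each $q$, $\wedge^q(\mathbb R^d)$ is regarded as a Euclidean space with orthonormal basis $\vec e_{i_1}\wedge\cdots\wedge\vec e_{i_q}$, $1\leq i_1<\cdots<i_q\leq d$, and $|\cdot|$ denotes the sup-norm of coordinates in this basis ($\wedge^0=\mathbb R$ with absolute value). $\wedge^p(\mathbb Z^d)$ denotes the set of elements of $\wedge^p(\mathbb R^d)$ with integer coordinates. For $\sigma=\{i_1<\cdots<i_k\}\subseteq\{1,\ldots,d\}$ set $\vec L_\sigma=\boldsymbol\ell_{i_1}\wedge\cdots\wedge\boldsymbol\ell_{i_k}$,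 and $\vec L_\varnothing=1$. Let $\mathcal J_k$ be the set of $k$-element subsets of $\{1,\ldots,m\}$. For $1\le p\le d-1$ set $k_0=\max(0,m-p)$. The $p$-th regular (resp. uniform) Diophantine exponent of the second type $\mathfrak b_p$ (resp. $\mathfrak a_p$) of $\Theta$ is the supremum of real $\gamma$ such that there are arbitrarily large $t$ for which (resp. such that for every sufficiently large $t$) the system \[ \max_{\sigma\in\mathcal J_k}|\vec L_\sigma\wedge\vec Z|\leq t^{1-(k-k_0)(1+\gamma)},\qquad k=0,\ldots,m, \] has a nonzero solution $\vec Z\in\wedge^p(\mathbb Z^d)$. *)

(* Defs.v *)
From mathcomp Require Import all_boot all_order all_algebra.
From mathcomp Require Import all_classical all_reals all_analysis.
Set Implicit Arguments.
Unset Strict Implicit.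
Unset Printing Implicit Defensive.
Import Order.TTheory GRing.Theory Num.Theory.
Import numFieldNormedType.Exports.
Local Open Scope ring_scope.

(* The whole exterior algebra of R^d, in coordinates: [Z I] is the coordinate
   of Z on e_{i_1} /\ ... /\ e_{i_q}, where I = {i_1 < ... < i_q}. *)
Definition multivec (R : realType) (d : nat) := {ffun {set 'I_d} -> R}.

(* The exterior powers /\^q(R^d) and /\^q(Z^d), inside the exterior algebra. *)
Definition extpower (R : realType) (d q : nat) (Z : multivec R d) : Prop :=
  forall I : {set 'I_d}, #|I| != q -> Z I = 0.

Definition int_extpower (R : realType) (d q : nat) (Z : multivec R d) : Prop :=
  extpower q Z /\ forall I : {set 'I_d}, Z I \is a Num.int.

Definition mv_one (R : realType) (d : nat) : multivec R d :=
  [ffun I => (I == finset.set0)%:R].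

Definition mv_vec (R : realType) (d : nat) (v : 'cV[R]_d) : multivec R d :=
  [ffun I => \sum_(i < d | I == [set i]%SET) v i ord0].

(* e_A /\ e_B = (-1)^(inversions A B) e_(A :|: B) for disjoint A and B. *)
Definition inversions (d : nat) (A B : {set 'I_d}) : nat :=
  #|[set ab : 'I_d * 'I_d |
      [&& ab.1 \in A, ab.2 \in B & (ab.2 < ab.1)%N]]%SET|.

Definition wedge (R : realType) (d : nat) (X Y : multivec R d) : multivec R d :=
  [ffun I : {set 'I_d} => \sum_(A : {set 'I_d} | A \subset I)
     (-1) ^+ inversions A (I :\: A) * X A * Y (I :\: A)].

Definition mv_norm (R : realType) (d : nat) (X : multivec R d) : R :=
  \big[Num.max/0]_(I : {set 'I_d}) `|X I|.

Definition ell_mx (R : realType) (m n : nat) (Theta : 'M[R]_(n, m)) :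
  'M[R]_(m + n) := block_mx 1%:M (- Theta^T) Theta 1%:M.

(* [enum sigma] lists sigma in increasing order. *)
Definition bigL (R : realType) (m n : nat) (Theta : 'M[R]_(n, m))
    (sigma : {set 'I_(m + n)}) : multivec R (m + n) :=
  \big[@wedge R (m + n)/mv_one R (m + n)]_(i <- enum sigma)
    mv_vec (col i (ell_mx Theta)).

Definition Jset (m n k : nat) : {set {set 'I_(m + n)}} :=
  [set s : {set 'I_(m + n)} |
    (#|s| == k) && (s \subset [set lshift n i | i in 'I_m])]%SET.

(* The truncated subtraction [(m - p)%N] is max(0, m - p). *)
Definition system_solvable (R : realType) (m n : nat) (Theta : 'M[R]_(n, m))
    (p : nat) (gamma t : R) : Prop :=
  exists Z : multivec R (m + n),
    [/\ int_extpower p Z, Z <> 0 &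
     forall k : nat, (k <= m)%N ->
       \big[Num.max/0]_(s in Jset m n k) mv_norm (wedge (bigL Theta s) Z)
         <= t `^ (1 - (k%:R - (m - p)%N%:R) * (1 + gamma))].

(* Both exponents take values in the extended reals, as they may be +oo. *)
Definition regular_exponent (R : realType) (m n : nat) (Theta : 'M[R]_(n, m))
    (p : nat) : \bar R :=
  ereal_sup [set gamma%:E | gamma in
    [set gamma : R | forall T : R,
       exists2 t : R, T < t & system_solvable Theta p gamma t]]%classic.

Definition uniform_exponent (R : realType) (m n : nat) (Theta : 'M[R]_(n, m))
    (p : nat) : \bar R :=
  ereal_sup [set gamma%:E | gamma in
    [set gamma : R | \forall t \near +oo,
       system_solvable Theta p gamma t]]%classic.

(* Main.v *)
Require Import Defs.
From mathcomp Require Import all_boot all_order all_algebra.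
From mathcomp Require Import all_classical all_reals all_analysis.
From mathcomp Require Import fintype finset ring lra zify.
Set Implicit Arguments.
Unset Strict Implicit.
Unset Printing Implicit Defensive.
Import Order.TTheory GRing.Theory Num.Theory.
Import numFieldNormedType.Exports.
Local Open Scope ring_scope.

(* By Mahler's compound bodies. Expand an integer p-vector Z in the basis L_rho. Up to
   constants the system says that |c_rho| Y^|rho \ {1..m}| <= t Y^max(0, p - m) for the
   coordinates c_rho of Z, where Y = t^(1 + gamma); that is, /\^p A Z has norm at most
   t Y^max(0, p - m), where A is the inverse of the matrix of the l_i with its last n rows
   multiplied by Y. Reduction of the lattice A Z^d gives A U = Q T with U
   unimodular, Q orthogonal, T upper triangular, and diagonal entries g_1, ..., g_d of T
   that decrease at most geometrically. Then a nonzero /\^p A Z has norm at least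
   c g_1 ... g_p, whereas the first p + 1 columns of U give an integer (p+1)-vector
   of norm at most C g_1 ... g_(p+1). As g_1 ... g_d = |det A| is Y^n up to a
   constant, the minima M_p satisfy M_(p+1)^(d-p) <= C' M_p^(d-p-1) Y^n, which
   becomes the asserted inequality between exponents. *)

(** * Coordinate calculus of the exterior algebra *)

Section Exterior.
Variables (R : realType) (d : nat).
Implicit Types (A B C I J : {set 'I_d}) (X Y W : multivec R d) (v w : 'cV[R]_d).
Implicit Types (M N : 'M[R]_d).

Lemma mvDE X Y I : (X + Y) I = X I + Y I. Proof. by rewrite ffunE. Qed.
Lemma mvZE (c : R) X I : (c *: X) I = c * X I. Proof. by rewrite ffunE. Qed.
Lemma mvNE X I : (- X) I = - X I. Proof. by rewrite ffunE. Qed.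
Lemma mvsumE (T : finType) (P : pred T) (F : T -> multivec R d) I :
  (\sum_(i | P i) F i) I = \sum_(i | P i) F i I.
Proof. by rewrite sum_ffunE. Qed.

Lemma inversionsUl A B C : [disjoint A & B] ->
  inversions (A :|: B) C = (inversions A C + inversions B C)%N.
Proof.
move=> dAB; rewrite /inversions -cardsUI [X in (_ + X)%N](_ : _ = 0)%N.
  rewrite addn0; apply: eq_card => -[a b]; rewrite !inE /=.
  by case: (a \in A); case: (a \in B); case: (b \in C); case: (b < a)%N.
apply: eq_card0 => -[a b]; rewrite !inE /=.
have := disjointFr dAB; move=> /(_ a).
by case: (a \in A) => //= ->; rewrite ?andbF.
Qed.

Lemma inversionsUr A B C : [disjoint A & B] ->
  inversions C (A :|: B) = (inversions C A + inversions C B)%N.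
Proof.
move=> dAB; rewrite /inversions -cardsUI [X in (_ + X)%N](_ : _ = 0)%N.
  rewrite addn0; apply: eq_card => -[a b]; rewrite !inE /=.
  by case: (b \in A); case: (b \in B); case: (a \in C); case: (b < a)%N.
apply: eq_card0 => -[a b]; rewrite !inE /=.
have := disjointFr dAB; move=> /(_ b).
by case: (b \in A) => [->|]; rewrite ?andbF.
Qed.

Lemma inversions1l (i : 'I_d) B :
  inversions [set i] B = #|[set j in B | (j < i)%N]|.
Proof.
rewrite /inversions -(card_imset [set j in B | (j < i)%N] (f := pair i)); last first.
  by move=> x y [].
apply: eq_card => -[a b]; rewrite !inE /=; apply/idP/imsetP.
  by case/and3P=> /eqP -> bB bi; exists b; rewrite ?inE ?bB.
by case=> j; rewrite !inE => /andP[jB ji] [-> ->]; rewrite eqxx jB.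
Qed.

Lemma inversionsC A B : [disjoint A & B] ->
  (inversions A B + inversions B A)%N = (#|A| * #|B|)%N.
Proof.
move=> dAB; rewrite -cardsX /inversions.
rewrite -(card_imset [set ab | [&& ab.1 \in B, ab.2 \in A & (ab.2 < ab.1)%N]]
  (f := fun ab => (ab.2, ab.1))); last by case=> ? ? [? ?] [] -> ->.
rewrite -cardsUI [X in (_ + X)%N](_ : _ = 0)%N.
  rewrite addn0; apply: eq_card => -[a b]; rewrite !inE /=.
  have -> : ((a, b) \in [set (ab.2, ab.1) | ab in [set ab | [&& ab.1 \in B, ab.2 \in A & (ab.2 < ab.1)%N]]])
     = [&& a \in A, b \in B & (a < b)%N].
    apply/imsetP/idP => [[[x y]] /[!inE] /= /and3P[xB yA yx] [-> ->]|].
      by rewrite yA xB.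
    by case/and3P=> aA bB ab; exists (b, a); rewrite ?inE /= ?aA ?bB.
  case: (boolP (a \in A)) => //= aA; case: (boolP (b \in B)) => //= bB.
  case: (ltngtP (a : nat) b) => // /val_inj ab.
  by move: (disjointFr dAB aA); rewrite ab bB.
apply: eq_card0 => -[a b]; rewrite !inE /=; apply/negbTE/negP => /andP[/and3P[_ _ ba]].
by case/imsetP=> -[x y] /[!inE] /= /and3P[_ _ yx] [] ax by_; move: ba yx; rewrite ax by_; lia.
Qed.

Lemma mv_vec_extpower v : extpower 1 (mv_vec v).
Proof.
move=> I cI; rewrite ffunE big_pred0 // => i; apply/negP => /eqP eI.
by move: cI; rewrite eI cards1.
Qed.

Lemma mv_vec_sum (T : finType) (f : T -> R) (u : T -> 'cV[R]_d) :
  mv_vec (\sum_t f t *: u t) = \sum_t f t *: mv_vec (u t).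
Proof.
apply/ffunP => I; rewrite ffunE mvsumE.
under [RHS]eq_bigr do rewrite mvZE ffunE mulr_sumr.
rewrite exchange_big /=; apply: eq_bigr => i _; rewrite summxE.
by apply: eq_bigr => t _; rewrite mxE.
Qed.

Lemma wedge_vecE v X I : wedge (mv_vec v) X I =
  \sum_(i in I) (-1) ^+ #|[set j in I | (j < i)%N]| * v i ord0 * X (I :\ i).
Proof.
rewrite ffunE.
transitivity (\sum_(A : {set 'I_d} | A \subset I) \sum_(i < d | A == [set i])
   (-1) ^+ inversions A (I :\: A) * v i ord0 * X (I :\: A)).
  by apply: eq_bigr => A AI; rewrite [mv_vec v A]ffunE mulr_sumr mulr_suml.
rewrite (exchange_big_dep xpredT) //= [RHS]big_mkcond /=; apply: eq_bigr => i _.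
rewrite (eq_bigl (fun A => (A == [set i]) && (A \subset I))); last by move=> A; rewrite andbC.
rewrite big_mkcondr big_pred1_eq sub1set.
case: ifP => // iI; congr (_ ^+ _ * _ * _); rewrite inversions1l.
by apply: eq_card => j; rewrite !inE; case: (eqVneq j i) => [->|]; rewrite ?ltnn ?andbF.
Qed.

Lemma wedgeDl X Y W : wedge (X + Y) W = wedge X W + wedge Y W.
Proof.
apply/ffunP => I; rewrite mvDE !ffunE -big_split; apply: eq_bigr => A _ /=.
by rewrite mvDE mulrDr mulrDl.
Qed.

Lemma wedgeDr X Y W : wedge W (X + Y) = wedge W X + wedge W Y.
Proof.
apply/ffunP => I; rewrite mvDE !ffunE -big_split; apply: eq_bigr => A _ /=.
by rewrite mvDE mulrDr.
Qed.

Lemma wedgeZl c X Y : wedge (c *: X) Y = c *: wedge X Y.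
Proof.
apply/ffunP => I; rewrite mvZE !ffunE mulr_sumr; apply: eq_bigr => A _ /=.
by rewrite mvZE; ring.
Qed.

Lemma wedgeZr c X Y : wedge X (c *: Y) = c *: wedge X Y.
Proof.
apply/ffunP => I; rewrite mvZE !ffunE mulr_sumr; apply: eq_bigr => A _ /=.
by rewrite mvZE; ring.
Qed.

Lemma wedge0l X : wedge 0 X = 0.
Proof. by rewrite -(scale0r (0 : multivec R d)) wedgeZl !scale0r. Qed.

Lemma wedge0r X : wedge X 0 = 0.
Proof. by rewrite -(scale0r (0 : multivec R d)) wedgeZr !scale0r. Qed.

Lemma wedge_suml (T : finType) (P : pred T) (F : T -> multivec R d) X :
  wedge (\sum_(t | P t) F t) X = \sum_(t | P t) wedge (F t) X.
Proof. exact: (big_morph (fun Y => wedge Y X) (fun Y Z => wedgeDl Y Z X) (wedge0l X)). Qed.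

Lemma wedge_sumr (T : finType) (P : pred T) (F : T -> multivec R d) X :
  wedge X (\sum_(t | P t) F t) = \sum_(t | P t) wedge X (F t).
Proof. exact: (big_morph (wedge X) (fun Y Z => wedgeDr Y Z X) (wedge0r X)). Qed.

(** Both sides sum over ordered partitions of [I] into three blocks, and the signs agree because
    inversions are additive over disjoint unions. *)
Lemma wedgeA X Y W : wedge X (wedge Y W) = wedge (wedge X Y) W.
Proof.
apply/ffunP => I; rewrite [LHS]ffunE [RHS]ffunE.
transitivity (\sum_(C : {set 'I_d} | C \subset I) \sum_(A : {set 'I_d} | A \subset C)
  (-1) ^+ (inversions C (I :\: C) + inversions A (C :\: A))
   * X A * Y (C :\: A) * W (I :\: C)); last first.
  apply: eq_bigr => C CI; rewrite [wedge X Y C]ffunE mulr_sumr mulr_suml.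
  by apply: eq_bigr => A sAC; rewrite exprD; ring.
rewrite (exchange_big_dep (fun A => A \subset I)) /=; last first.
  by move=> C A CI sAC; exact: (fintype.subset_trans sAC CI).
apply: eq_bigr => A AI; rewrite [wedge Y W _]ffunE mulr_sumr.
rewrite [RHS](reindex_onto (fun B => A :|: B) (fun C => C :\: A)) /=; last first.
  move=> C /andP[CI sAC]; apply/setP => x; rewrite !inE.
  by case: (boolP (x \in A)) => //= xA; rewrite (subsetP sAC).
apply: eq_big => B.
  rewrite subsetD subUset AI subsetUl andbT.
  case: (boolP (B \subset I)) => //= BI.
  apply/idP/eqP => [dBA|<-].
    apply/setP=> x; rewrite !inE; case: (boolP (x \in A)) => //= xA.
    by rewrite (disjointFl dBA).
  by rewrite -setI_eq0; apply/eqP/setP => x; rewrite !inE; case: (x \in A); rewrite ?andbF.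
rewrite subsetD => /andP[BI dBA].
have dAB : [disjoint A & B] by rewrite disjoint_sym.
have eB : (A :|: B) :\: A = B.
  apply/setP=> x; rewrite !inE; case: (boolP (x \in A)) => //= xA.
  by rewrite (disjointFl dBA).
have eI : I :\: A :\: B = I :\: (A :|: B).
  by apply/setP=> x; rewrite !inE negb_or andbA [(x \notin B) && _]andbC.
rewrite eB eI inversionsUl //.
have -> : inversions A (I :\: A) = (inversions A B + inversions A (I :\: (A :|: B)))%N.
  rewrite -inversionsUr; last first.
    by rewrite -setI_eq0; apply/eqP/setP => x; rewrite !inE; case: (x \in B); rewrite ?orbT ?andbF.
  congr inversions; apply/setP => x; rewrite !inE.
  case: (boolP (x \in B)) => xB; rewrite ?orbT ?orbF //=.
  by rewrite (disjointFr dBA xB) (subsetP BI).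
by rewrite !exprD; ring.
Qed.

Lemma wedge_vecC v w : wedge (mv_vec v) (mv_vec w) = - wedge (mv_vec w) (mv_vec v).
Proof.
apply/ffunP => I; rewrite mvNE !ffunE.
(* Passing to complements in [I] swaps the two factors; only pairs of singletons survive, and their
   two orders have opposite parity. *)
rewrite (reindex_onto (fun B => I :\: B) (fun B => I :\: B)) /=; last first.
  by move=> A AI; rewrite setDDr setDv set0U; apply/setIidPr.
rewrite -sumrN; apply: eq_big => A.
  rewrite subsetDl setDDr setDv set0U /=.
  by apply/eqP/idP => /setIidPr.
rewrite subsetDl setDDr setDv set0U /= => /eqP eA; rewrite eA.
have dA : [disjoint A & I :\: A] by rewrite -setI_eq0 setIDA setDIl setDv set0I.
case: (eqVneq #|A| 1%N) => [cA|cA]; last by rewrite (mv_vec_extpower w cA) !(mulr0, mul0r) oppr0.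
case: (eqVneq #|I :\: A| 1%N) => [cB|cB]; last by rewrite (mv_vec_extpower v cB) !(mulr0, mul0r) oppr0.
have := inversionsC dA; rewrite cA cB muln1.
case: (inversions A _) => [|[|?]]; case: (inversions _ A) => [|[|?]] //= _; rewrite ?expr0 ?expr1; ring.
Qed.

Lemma wedge_vecCA v w X :
  wedge (mv_vec v) (wedge (mv_vec w) X) = - wedge (mv_vec w) (wedge (mv_vec v) X).
Proof. by rewrite !wedgeA wedge_vecC -scaleN1r wedgeZl scaleN1r. Qed.

Lemma wedge_vecvA v X : wedge (mv_vec v) (wedge (mv_vec v) X) = 0.
Proof.
have := wedge_vecCA v v X => h; apply/ffunP => I; move/ffunP: h => /(_ I).
by rewrite mvNE => e; rewrite [RHS]ffunE; lra.
Qed.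

Lemma wedge1l X : wedge (mv_one R d) X = X.
Proof.
apply/ffunP => I; rewrite ffunE (bigD1 set0) ?sub0set //= big1 ?addr0.
  rewrite ffunE eqxx mulr1 setD0.
  rewrite /inversions (_ : #|_| = 0)%N ?mul1r //.
  by apply: eq_card0 => -[a b]; rewrite !inE.
by move=> A /andP[_ /negbTE nA]; rewrite ffunE nA mulr0 mul0r.
Qed.

(** Adding a new least element matches the increasing order of [enum], so that a wedge of columns
    unfolds from the left. *)
Lemma set_min_ind (P : {set 'I_d} -> Prop) : P set0 ->
  (forall (j : 'I_d) I, (forall k, k \in I -> (j < k)%N) -> P I -> P (j |: I)) ->
  forall I, P I.
Proof.
move=> P0 PS I; move: {2}#|I| (erefl #|I|) => n; elim: n I => [|n IH] I cI.
  by move/eqP: cI; rewrite cards_eq0 => /eqP ->.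
have /card_gt0P[i0 i0I] : (0 < #|I|)%N by rewrite cI.
case: (arg_minnP (fun i : 'I_d => i : nat) i0I) => j jI' jmin; have jI : j \in I by [].
rewrite -(setD1K jI); apply: PS => [k|].
  by rewrite !inE => /andP[kj /jmin]; rewrite leq_eqVlt eq_sym (inj_eq val_inj) (negbTE kj).
by apply: IH; move: cI; rewrite (cardsD1 j) jI => -[].
Qed.

(** * Wedges of columns and the induced endomorphism *)

Definition bigwedge M I : multivec R d :=
  \big[@wedge R d/mv_one R d]_(i <- enum I) mv_vec (col i M).

Lemma bigwedge0 M : bigwedge M set0 = mv_one R d.
Proof. by rewrite /bigwedge enum_set0 big_nil. Qed.

Lemma bigwedgeU1 M (j : 'I_d) I : (forall k : 'I_d, k \in I -> (j < k)%N) ->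
  bigwedge M (j |: I) = wedge (mv_vec (col j M)) (bigwedge M I).
Proof.
move=> jI; rewrite /bigwedge.
suff -> : enum (j |: I) = j :: enum I by rewrite big_cons.
have ltn_tr : transitive (fun i k : 'I_d => (i < k)%N) by move=> ? ? ?; apply: ltn_trans.
have ltn_ir : irreflexive (fun i k : 'I_d => (i < k)%N) by move=> ?; apply: ltnn.
have sorted_enum (S : {set 'I_d}) : sorted (fun i k : 'I_d => (i < k)%N) (enum S).
  rewrite {1}/enum_mem; apply: sorted_filter => //.
  have := iota_ltn_sorted 0 d; rewrite -val_enum_ord sorted_map.
  by rewrite enumT.
apply: (irr_sorted_eq ltn_tr ltn_ir) => //.
  rewrite /= path_min_sorted ?sorted_enum //.
  by apply/allP => k; rewrite mem_enum; apply: jI.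
by move=> k; rewrite inE !mem_enum !inE.
Qed.

(* The algebra endomorphism /\M of the exterior algebra, on all degrees at once. *)
Definition extend M X : multivec R d := \sum_I X I *: bigwedge M I.

(** The column moves right to its place in increasing order, with one sign for each smaller index
    passed; a repeated column kills the product. *)
Lemma wedge_col_bigwedge M i I :
  wedge (mv_vec (col i M)) (bigwedge M I) =
  if i \in I then 0 else (-1) ^+ #|[set j in I | (j < i)%N]| *: bigwedge M (i |: I).
Proof.
elim/set_min_ind: I => [|j I jI IH].
  rewrite inE (_ : #|_| = 0%N) ?expr0 ?scale1r; last first.
    by apply: eq_card0 => k; rewrite !inE.
  by rewrite bigwedgeU1 // => k; rewrite inE.
rewrite (bigwedgeU1 M jI) !inE.
case: (ltngtP i j) => [ij|ji|/val_inj ->]; last by rewrite eqxx wedge_vecvA.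
- have ni : i \notin I by apply/negP => /jI; lia.
  have nij : i != j by apply: contraTneq ij => ->; rewrite ltnn.
  rewrite (negbTE ni) (negbTE nij) /= (_ : #|_| = 0%N) ?expr0 ?scale1r.
    rewrite -bigwedgeU1 // -bigwedgeU1 // => k; rewrite !inE => /orP[/eqP->//|/jI]; lia.
  apply: eq_card0 => k; rewrite !inE.
  by case: eqP => [->|_] /=; [lia|apply/negP => /andP[/jI]; lia].
have nij : i != j by apply: contraTneq ji => ->; rewrite ltnn.
rewrite (negbTE nij) wedge_vecCA IH /=; case: (boolP (i \in I)) => [_|ni].
  by rewrite wedge0r oppr0.
rewrite wedgeZr -bigwedgeU1; last by move=> k; rewrite !inE => /orP[/eqP->//|/jI].
rewrite -scaleNr setUCA; congr (_ *: _).
rewrite (cardsD1 j [set _ in j |: I | _]) !inE eqxx ji /= exprS mulN1r; congr (- _ ^+ _).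
apply: eq_card => k; rewrite !inE; case: (eqVneq k j) => //= ->.
by apply/negP => /andP[/jI]; rewrite ltnn.
Qed.

Lemma extendD M X Y : extend M (X + Y) = extend M X + extend M Y.
Proof. by rewrite -big_split; apply: eq_bigr => I _; rewrite mvDE scalerDl. Qed.

Lemma extendZ M c X : extend M (c *: X) = c *: extend M X.
Proof. by rewrite /extend scaler_sumr; apply: eq_bigr => I _; rewrite mvZE scalerA. Qed.

Lemma extend0 M : extend M 0 = 0.
Proof. by rewrite -(scale0r (0 : multivec R d)) extendZ !scale0r. Qed.

Lemma extend_sum M (T : finType) (P : pred T) (F : T -> multivec R d) :
  extend M (\sum_(t | P t) F t) = \sum_(t | P t) extend M (F t).
Proof. exact: (big_morph (extend M) (extendD M) (extend0 M)). Qed.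

Lemma mulmx_cols M v : M *m v = \sum_i v i ord0 *: col i M.
Proof.
apply/colP => k; rewrite summxE mxE; apply: eq_bigr => i _.
by rewrite !mxE mulrC.
Qed.

(** Bilinearity reduces this to single columns. Left multiplication by a vector is enough: induction
    on least elements then handles every wedge of columns. *)
Lemma extend_wedge_vec M v X :
  extend M (wedge (mv_vec v) X) = wedge (mv_vec (M *m v)) (extend M X).
Proof.
rewrite mulmx_cols mv_vec_sum wedge_suml /extend.
under eq_bigr do rewrite wedge_vecE scaler_suml.
rewrite (exchange_big_dep xpredT) //=; apply: eq_bigr => i _.
rewrite wedgeZl wedge_sumr scaler_sumr.
rewrite [RHS](bigID (fun I : {set 'I_d} => i \in I)) /= [X in _ = X + _]big1 ?add0r; last first.
  by move=> I iI; rewrite wedgeZr wedge_col_bigwedge iI !scaler0.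
rewrite [RHS](reindex_onto (fun I => I :\ i) (fun I => i |: I)) /=; last first.
  by move=> I iI; rewrite setU1K.
apply: eq_big => I.
  rewrite !inE eqxx /=; apply/idP/eqP => [/setD1K//|<-].
  by rewrite setU11.
move=> iI; rewrite wedgeZr wedge_col_bigwedge !inE eqxx /= setD1K // !scalerA.
congr (_ *: _); rewrite [#|[set j in I | _]|](_ : _ = #|[set j in I :\ i | (j < i)%N]|).
  by ring.
by apply: eq_card => j; rewrite !inE; case: (eqVneq j i) => [->|]; rewrite ?ltnn ?andbF.
Qed.

Lemma extend_one M : extend M (mv_one R d) = mv_one R d.
Proof.
rewrite /extend (bigD1 set0) //= ffunE eqxx scale1r bigwedge0 big1 ?addr0 //.
by move=> I /negbTE nI; rewrite ffunE nI scale0r.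
Qed.

(** This is the Cauchy-Binet formula, since the coordinates of [bigwedge] are minors. *)
Lemma bigwedge_mul M N I : bigwedge (M *m N) I = extend M (bigwedge N I).
Proof.
elim/set_min_ind: I => [|j I jI IH]; first by rewrite !bigwedge0 extend_one.
by rewrite !bigwedgeU1 // extend_wedge_vec IH !colE mulmxA.
Qed.

Lemma extend_mul M N X : extend (M *m N) X = extend M (extend N X).
Proof.
rewrite {1 3}/extend extend_sum; apply: eq_bigr => I _.
by rewrite extendZ bigwedge_mul.
Qed.

Lemma bigwedge1E I J : bigwedge 1%:M I J = (J == I)%:R.
Proof.
elim/set_min_ind: I J => [|j I jI IH] J; first by rewrite bigwedge0 ffunE.
have nj : j \notin I by apply/negP => /jI; rewrite ltnn.
rewrite bigwedgeU1 // wedge_vecE.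
case: (boolP (j \in J)) => jJ; last first.
  rewrite big1 => [|i iJ].
    by case: eqP => // eJ; move: jJ; rewrite eJ setU11.
  rewrite !mxE; case: eqP => [ij|]; last by rewrite mulr0 mul0r.
  by move: jJ; rewrite -ij iJ.
rewrite (bigD1 j) //= big1 ?addr0 => [|i /andP[_ /negbTE ij]]; last first.
  by rewrite !mxE ij mulr0 mul0r.
rewrite !mxE eqxx mulr1 IH.
have -> : (J :\ j == I) = (J == j |: I).
  by apply/eqP/eqP => [<-|->]; rewrite ?setD1K ?setU1K.
case: eqP => [eJ|]; last by rewrite mulr0.
rewrite (_ : #|_| = 0%N) ?mulr1 //; apply: eq_card0 => k; rewrite eJ !inE.
by case: eqP => [->|_] /=; rewrite ?ltnn //; apply/negP => /andP[/jI]; lia.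
Qed.

Lemma extend1 X : extend 1%:M X = X.
Proof.
apply/ffunP => I; rewrite mvsumE (bigD1 I) //= mvZE bigwedge1E eqxx mulr1 big1 ?addr0 //.
by move=> J /negbTE nJ; rewrite mvZE bigwedge1E eq_sym nJ mulr0.
Qed.

(** In the basis of the columns of [M], wedging with some of these columns becomes wedging with
    coordinate vectors. With [M] the matrix of the l_i, this isolates the coordinates of Z. *)
Lemma wedge_bigwedge_extend M I X :
  wedge (bigwedge M I) (extend M X) = extend M (wedge (bigwedge 1%:M I) X).
Proof.
elim/set_min_ind: I => [|j I jI IH]; first by rewrite !bigwedge0 !wedge1l.
by rewrite !bigwedgeU1 // -!wedgeA IH extend_wedge_vec [in RHS]colE mul1mx -colE.
Qed.

Lemma wedge_bigwedge1E I X J : wedge (bigwedge 1%:M I) X J =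
  if I \subset J then (-1) ^+ inversions I (J :\: I) * X (J :\: I) else 0.
Proof.
rewrite ffunE; case: ifP => IJ; last first.
  by rewrite big1 // => A AJ; rewrite bigwedge1E; case: eqP AJ => [->|_]; rewrite ?IJ ?mulr0 ?mul0r.
rewrite (bigD1 I) //= bigwedge1E eqxx mulr1 big1 ?addr0 // => A /andP[_ /negbTE nA].
by rewrite bigwedge1E nA mulr0 mul0r.
Qed.

Lemma bigwedge_extpower M I : extpower #|I| (bigwedge M I).
Proof.
elim/set_min_ind: I => [|j I jI IH] J.
  by rewrite bigwedge0 ffunE cards0 cards_eq0 => /negbTE ->.
have nj : j \notin I by apply/negP => /jI; rewrite ltnn.
rewrite cardsU1 nj bigwedgeU1 // wedge_vecE => cJ; rewrite big1 // => i iJ.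
by rewrite IH ?mulr0 //; move: cJ; rewrite (cardsD1 i) iJ eqSS.
Qed.

Lemma extend_extpower M q X : extpower q X -> extpower q (extend M X).
Proof.
move=> hX J cJ; rewrite mvsumE big1 // => I _; rewrite mvZE.
case: (eqVneq #|I| q) => [cI|cI]; last by rewrite hX ?mul0r.
by rewrite bigwedge_extpower ?mulr0 // cI.
Qed.

Lemma bigwedge_int M I J : (forall i j, M i j \is a Num.int) ->
  bigwedge M I J \is a Num.int.
Proof.
move=> hM; elim/set_min_ind: I J => [|j I jI IH] J.
  by rewrite bigwedge0 ffunE natr_int.
rewrite bigwedgeU1 // wedge_vecE rpred_sum // => i iJ.
by rewrite !rpredM // ?mxE // rpredX // rpredN rpred1.
Qed.

Lemma extend_int M X : (forall i j, M i j \is a Num.int) ->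
  (forall I, X I \is a Num.int) -> forall I, extend M X I \is a Num.int.
Proof.
by move=> hM hX I; rewrite mvsumE rpred_sum // => J _; rewrite mvZE rpredM ?bigwedge_int.
Qed.

Lemma bigwedge_bound M (B : R) I J : 1 <= B -> (forall i j, `|M i j| <= B) ->
  `|bigwedge M I J| <= (d%:R * B) ^+ #|I|.
Proof.
move=> B1 hM; elim/set_min_ind: I J => [|j I jI IH] J.
  by rewrite bigwedge0 ffunE cards0 expr0; case: eqP; rewrite ?normr1 ?normr0.
have nj : j \notin I by apply/negP => /jI; rewrite ltnn.
rewrite bigwedgeU1 // wedge_vecE cardsU1 nj add1n exprS.
apply: (le_trans (ler_norm_sum _ _ _)).
apply: (@le_trans _ _ (\sum_(i in J) B * (d%:R * B) ^+ #|I|)).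
  apply: ler_sum => i iJ; rewrite !normrM normrX normrN1 expr1n mul1r mxE.
  by apply: ler_pM.
rewrite sumr_const -mulrA -[leLHS]mulr_natl ler_wpM2r //.
  by rewrite mulr_ge0 ?exprn_ge0 ?mulr_ge0 ?(le_trans _ B1).
by rewrite ler_nat -[leqRHS]card_ord max_card.
Qed.

(** The constant depends on [B] and [d] but not on [M]: it has to serve orthogonal matrices that
    vary with t. *)
Lemma extend_bound (B : R) : exists2 C : R, 1 <= C &
  forall M, (forall i j, `|M i j| <= B) ->
  forall X (K : R), (forall I, `|X I| <= K) -> forall I, `|extend M X I| <= C * K.
Proof.
pose B' := Num.max 1 B.
have B1 : 1 <= B' by rewrite le_max lexx.
pose C1 := \sum_(J : {set 'I_d}) (d%:R * B') ^+ #|J|.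
have C10 : 0 <= C1 by apply: sumr_ge0 => J _; rewrite exprn_ge0 ?mulr_ge0 ?(le_trans _ B1).
exists (1 + C1); first by rewrite lerDl.
move=> M hM X K hX I.
have K0 : 0 <= K by apply: le_trans (hX I).
rewrite mvsumE (le_trans (ler_norm_sum _ _ _)) //.
rewrite mulrDl mul1r (le_trans (_ : _ <= C1 * K)) ?lerDr //.
rewrite mulr_suml ler_sum // => J _; rewrite mvZE normrM mulrC ler_pM //.
by apply: bigwedge_bound => // i j; rewrite le_max hM orbT.
Qed.

(** * Triangular matrices on exterior powers *)

Definition set_weight I := (\sum_(i in I) i)%N.

Lemma set_weightD1 I i : i \in I -> set_weight I = (i + set_weight (I :\ i))%N.
Proof. by move=> iI; rewrite /set_weight (big_setD1 i). Qed.

(** Column [j] lives in the rows up to [j], so expanding a wedge of columns can only lower indices.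
    The sum of indices thus orders the basis so that the induced map is triangular. *)
Lemma bigwedge_triangular M I J :
  (forall i j : 'I_d, (j < i)%N -> M i j = 0) ->
  bigwedge M I J != 0 -> J = I \/ (set_weight J < set_weight I)%N.
Proof.
move=> hM; elim/set_min_ind: I J => [|j I jI IH] J.
  by rewrite bigwedge0 ffunE; case: (eqVneq J set0) => [->|_]; [left|rewrite eqxx].
have nj : j \notin I by apply/negP => /jI; rewrite ltnn.
rewrite bigwedgeU1 // wedge_vecE.
case: (pickP (fun i => (i \in J) && (M i j * bigwedge M I (J :\ i) != 0))) => [i|no]; last first.
  rewrite big1 ?eqxx // => i iJ; have := no i; rewrite iJ /= mxE => /negbFE /eqP h.
  by rewrite -mulrA h mulr0.
case/andP=> iJ; rewrite mulf_eq0 negb_or => /andP[Mij /IH hJ] _.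
have ij : (i <= j)%N by rewrite leqNgt; apply: contra Mij => /hM ->.
rewrite (set_weightD1 iJ) (set_weightD1 (setU11 j I)) setU1K //.
case: hJ => [eJ|]; last by right; lia.
rewrite eJ; case: (ltngtP i j) ij => // [ij _|/val_inj ij _]; first by right; lia.
by left; rewrite -(setD1K iJ) eJ ij.
Qed.

Lemma bigwedge_triangular_diag M I :
  (forall i j : 'I_d, (j < i)%N -> M i j = 0) ->
  bigwedge M I I = \prod_(i in I) M i i.
Proof.
move=> hM; elim/set_min_ind: I => [|j I jI IH].
  by rewrite bigwedge0 ffunE eqxx big_set0.
have nj : j \notin I by apply/negP => /jI; rewrite ltnn.
rewrite bigwedgeU1 // wedge_vecE (bigD1 j) ?setU11 //= big1 ?addr0.
  rewrite setU1K // IH mxE [RHS](big_setD1 j) ?setU11 //= setU1K //.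
  rewrite (_ : #|_| = 0%N) ?mul1r //; apply: eq_card0 => k; rewrite !inE.
  by case: eqP => [->|_] /=; rewrite ?ltnn //; apply/negP => /andP[/jI]; lia.
move=> i /andP[iJ ij]; rewrite mxE.
have [iI|] := boolP (i \in I); last by move: iJ; rewrite !inE (negbTE ij) /= => ->.
by rewrite hM ?mulr0 ?mul0r // jI.
Qed.

(** A set [I] of maximal weight in the support of [X] receives no contribution from the other sets,
    so its coordinate is only scaled by the diagonal. *)
Lemma extend_triangular_lower M X : X <> 0 ->
  (forall i j : 'I_d, (j < i)%N -> M i j = 0) ->
  exists2 I, X I != 0 & extend M X I = X I * \prod_(i in I) M i i.
Proof.
move=> X0 hM.
have [I0 XI0] : exists I, X I != 0.
  apply/existsP; apply: contra_notT X0 => /existsPn h; apply/ffunP => I.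
  by have := h I; rewrite negbK => /eqP ->; rewrite ffunE.
case: (@arg_maxnP _ I0 (fun I => X I != 0) set_weight XI0) => I XI Imax.
exists I => //; rewrite mvsumE (bigD1 I) //= mvZE bigwedge_triangular_diag //.
rewrite [X in _ + X]big1 ?addr0 // => J /negP JI; rewrite mvZE.
have [->|XJ] := eqVneq (X J) 0; first by rewrite mul0r.
have [->|TJ] := eqVneq (bigwedge M J I) 0; first by rewrite mulr0.
case: (bigwedge_triangular hM TJ) => [e|]; first by case: JI; rewrite e.
by have := Imax _ XJ; lia.
Qed.

End Exterior.

(** * Reduction of positive definite quadratic forms over the integers *)

Section Reduction.
Variable R : realType.

Definition intmx a b (M : 'M[R]_(a, b)) := forall i j, M i j \is a Num.int.

Definition qform d (G : 'M[R]_d) (x : 'cV[R]_d) : R := (x^T *m G *m x) ord0 ord0.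

Definition sqnorm d (x : 'cV[R]_d) : R := \sum_i x i ord0 ^+ 2.

(** Positive definiteness in quantitative form: it keeps the values at nonzero integer vectors away
    from zero without a compactness argument. *)
Definition coercive d (G : 'M[R]_d) :=
  exists2 e : R, 0 < e & forall x, e * sqnorm x <= qform G x.

Lemma intmxM a b c (M : 'M[R]_(a, b)) (N : 'M[R]_(b, c)) :
  intmx M -> intmx N -> intmx (M *m N).
Proof. by move=> hM hN i j; rewrite mxE rpred_sum // => k _; rewrite rpredM. Qed.

Lemma intmx_map a b (M : 'M[int]_(a, b)) : intmx (map_mx intr M).
Proof. by move=> i j; rewrite mxE intr_int. Qed.

Lemma intmx1 d : intmx (1%:M : 'M[R]_d).
Proof. by move=> i j; rewrite mxE; case: eqP; rewrite ?rpred1 ?rpred0. Qed.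

Lemma intmx_block a b c e (A : 'M[R]_(a, b)) B C (D : 'M[R]_(c, e)) :
  intmx A -> intmx B -> intmx C -> intmx D -> intmx (block_mx A B C D).
Proof.
move=> hA hB hC hD i j; rewrite -(splitK i) -(splitK j).
case: (split i) => i'; case: (split j) => j' /=.
- by rewrite block_mxEul.
- by rewrite block_mxEur.
- by rewrite block_mxEdl.
- by rewrite block_mxEdr.
Qed.

Lemma sqnorm_ge0 d (x : 'cV[R]_d) : 0 <= sqnorm x.
Proof. by apply: sumr_ge0 => i _; rewrite sqr_ge0. Qed.

Lemma sqnorm_ge d (x : 'cV[R]_d) i : x i ord0 ^+ 2 <= sqnorm x.
Proof. by rewrite /sqnorm (bigD1 i) //= lerDl sumr_ge0 // => j _; rewrite sqr_ge0. Qed.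

Lemma sqnormE d (x : 'cV[R]_d) : sqnorm x = (x^T *m x) ord0 ord0.
Proof. by rewrite mxE; apply: eq_bigr => i _; rewrite mxE expr2. Qed.

Lemma qform_mul d (U : 'M[R]_d) G x : qform (U^T *m G *m U) x = qform G (U *m x).
Proof. by rewrite /qform trmx_mul !mulmxA. Qed.

Lemma qform_delta d (G : 'M[R]_d) i : qform G (delta_mx i ord0) = G i i.
Proof. by rewrite /qform trmx_delta -mulmxA -colE -rowE !mxE. Qed.

Lemma sqnorm_mul_bound d (M : 'M[R]_d) :
  exists2 K, 0 < K & forall x, sqnorm (M *m x) <= K * sqnorm x.
Proof.
pose B := 1 + \sum_i \sum_j `|M i j|.
have B0 : 0 <= \sum_i \sum_j `|M i j| by do 2!apply: sumr_ge0 => ? _.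
have hM i j : `|M i j| <= B.
  have h1 : `|M i j| <= \sum_j `|M i j| by rewrite (bigD1 j) //= lerDl sumr_ge0.
  have h2 : \sum_j `|M i j| <= \sum_i \sum_j `|M i j|.
    by rewrite [leRHS](bigD1 i) //= lerDl; do 2!apply: sumr_ge0 => ? _.
  by apply: (le_trans h1); apply: (le_trans h2); rewrite lerDr.
exists (1 + \sum_(i < d) (d%:R * B) ^+ 2).
  by rewrite ltr_wpDr ?ltr01 // sumr_ge0 // => i _; rewrite sqr_ge0.
move=> x; rewrite mulrDl mul1r (le_trans _ (_ : (\sum_(i < d) (d%:R * B) ^+ 2) * sqnorm x <= _)) ?lerDr ?sqnorm_ge0 //.
rewrite mulr_suml; apply: ler_sum => i _.
rewrite -[sqnorm x]sqr_sqrtr ?sqnorm_ge0 // -exprMn -[leLHS]real_normK ?num_real //.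
rewrite lerXn2r ?nnegrE ?mulr_ge0 ?sqrtr_ge0 ?addr_ge0 //.
rewrite mxE (le_trans (ler_norm_sum _ _ _)) //.
apply: (@le_trans _ _ (\sum_(j < d) B * Num.sqrt (sqnorm x))).
  apply: ler_sum => j _; rewrite normrM ler_pM // -sqrtr_sqr ler_wsqrtr //.
  exact: sqnorm_ge.
by rewrite sumr_const card_ord -mulrA mulr_natl.
Qed.

Lemma coercive_mul d (U V : 'M[R]_d) G : V *m U = 1%:M -> coercive G ->
  coercive (U^T *m G *m U).
Proof.
move=> VU [e e0 he]; have [K K0 hK] := sqnorm_mul_bound V.
exists (e / K) => [|x]; first by rewrite divr_gt0.
rewrite qform_mul (le_trans _ (he _)) // -mulrA ler_pM2l // ler_pdivrMl //.
by rewrite -[x in sqnorm x](mul1mx x) -VU -mulmxA.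
Qed.

Lemma int_sqnorm_ge1 d (z : 'cV[R]_d) : intmx z -> z != 0 -> 1 <= sqnorm z.
Proof.
move=> hz; case/cV0Pn => i zi; apply: le_trans (sqnorm_ge z i).
by rewrite -[leRHS]real_normK ?num_real // exprn_ege1 // norm_intr_ge1.
Qed.

(** The infimum over nonzero integer vectors is positive, so some value lies within a factor 2 of
    it. This spares a proof that the minimum is attained. *)
Lemma int_near_min d (G : 'M[R]_(1 + d)) : coercive G ->
  exists v, [/\ intmx v, v != 0 &
    forall z, intmx z -> z != 0 -> qform G v <= 2 * qform G z].
Proof.
case=> e e0 he.
pose E := [set qform G z | z in [set z : 'cV[R]_(1 + d) | intmx z /\ z != 0]]%classic.
have lbE : lbound E e.
  move=> _ [z [hz z0] <-]; apply: le_trans (he z).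
  by rewrite ler_peMr ?int_sqnorm_ge1 // ltW.
have nE : (nonempty E)%classic.
  exists (qform G (delta_mx ord0 ord0)), (delta_mx ord0 ord0) => //; split.
    by move=> i j; rewrite mxE natr_int.
  by apply/cV0Pn; exists ord0; rewrite mxE !eqxx oner_eq0.
have infE : 0 < inf E by apply: lt_le_trans e0 (lb_le_inf nE lbE).
have [|_ [v [hv v0] <-] hvq] := inf_adherent infE (E := E); first by split => //; exists e.
exists v; split => // z hz z0; apply: ltW; apply: lt_le_trans hvq _.
rewrite mulrDl mul1r lerD //; apply: ge_inf; (by exists e) || by exists z.
Qed.

(** The Smith normal form of a one-column matrix has at most one nonzero entry, so [v] is a multiple
    of the first column of a unimodular matrix. *)
Lemma int_column_primitive d (v : 'cV[R]_(1 + d)) : intmx v ->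
  exists U V : 'M[R]_(1 + d), exists2 c : R, c \is a Num.int &
    [/\ intmx U, intmx V, U *m V = 1%:M & v = c *: col ord0 U].
Proof.
move=> hv.
pose vz : 'cV[int]_(1 + d) := \matrix_(i, j) Num.floor (v i j).
have -> : v = map_mx intr vz.
  by apply/matrixP => i j; rewrite !mxE; apply/esym/eqP; rewrite -intrEfloor.
have [L uL [S uS [s _ ->]]] := int_Smith_normal_form vz.
exists (map_mx intr L), (map_mx intr (invmx L)), (s`_0 * S ord0 ord0)%:~R.
  exact: intr_int.
split; try exact: intmx_map.
  by rewrite -map_mxM mulmxV // map_mx1.
apply/colP => i; rewrite !mxE big_ord1 mxE (bigD1 ord0) //= big1 => [|j j0].
  by rewrite addr0 !mxE eqxx mulr1n -intrM; congr (_%:~R); move: (S _ _) (L _ _) => x y; ring.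
rewrite !mxE (_ : (j == 0 :> nat) = false) ?mulr0n ?mulr0 //.
exact: negbTE.
Qed.

(** Completing the square: the residual form is the Schur complement of [a]. *)
Lemma qform_block d (a : R) (b : 'rV[R]_d) (C : 'M[R]_d) (x : R) (w : 'cV[R]_d) :
  a != 0 ->
  qform (block_mx a%:M b b^T C) (col_mx x%:M w) =
  a^-1 * (a * x + (b *m w) ord0 ord0) ^+ 2 + qform (C - a^-1 *: (b^T *m b)) w.
Proof.
move=> a0; rewrite /qform tr_col_mx mul_row_block mul_row_col.
rewrite mulmxBr mulmxBl -scalemxAr -scalemxAl !mulmxA !mulmxDl.
set be := b *m w.
have -> : w^T *m b^T *m b *m w = be^T *m be by rewrite -!mulmxA trmx_mul !mulmxA.
have -> : w^T *m b^T *m x%:M = be^T *m x%:M by rewrite trmx_mul.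
rewrite -[x%:M^T *m b *m w]mulmxA -/be tr_scalar_mx.
rewrite !mxE !big_ord1 !mxE !big_ord1 !mxE eqxx !mulr1n.
move: (\sum_j _) (\sum_j _) => s s'; field.
by [].
Qed.

Lemma nearest_int (y : R) : exists2 x, x \is a Num.int & (x - y) ^+ 2 <= 4^-1.
Proof.
exists (Num.floor (y + 2^-1))%:~R; first exact: intr_int.
have := floor_le_tmp (y + 2^-1); have := floorD1_gt (y + 2^-1).
rewrite intrD; move: (_%:~R) => f; rewrite mulr1z => h1 h2.
have : - 2^-1 <= f - y <= 2^-1 by apply/andP; split; lra.
move: (f - y) => z /andP[? ?]; nra.
Qed.

(* The diagonal of T is that of a Hermite-Korkin-Zolotarev reduction, except that
   each basis vector is only required to be minimal up to a factor 2. *)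
Lemma gram_reduction d (G : 'M[R]_d) : G^T = G -> coercive G ->
  exists U V T : 'M[R]_d,
    [/\ [/\ intmx U, intmx V & U *m V = 1%:M], U^T *m G *m U = T^T *m T,
        forall i j : 'I_d, (j < i)%N -> T i j = 0, forall i, 0 < T i i &
        forall i j : 'I_d, j = i.+1 :> nat -> T i i <= 2 * T j j].
Proof.
elim: d G => [|d IH] G symG cG.
  exists 1%:M, 1%:M, 1%:M; split; [|by apply/matrixP => -[]|by case|by case|by case].
  by split; rewrite ?mul1mx //; exact: intmx1.
move: G symG cG; rewrite -[d.+1]/(1 + d)%N => G symG cG.
have [v [hv v0 vmin]] := int_near_min cG.
have [U1 [V1 [c hc [hU1 hV1 UV1 ev]]]] := int_column_primitive hv.
have VU1 : V1 *m U1 = 1%:M by apply: mulmx1C.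
pose G1 := U1^T *m G *m U1.
have symG1 : G1^T = G1 by rewrite !trmx_mul trmxK symG mulmxA.
have cG1 : coercive G1 by apply: coercive_mul VU1 cG.
pose b := ursubmx G1; pose C := drsubmx G1; pose a := G1 ord0 ord0.
have eG1 : G1 = block_mx a%:M b b^T C.
  rewrite -[LHS]submxK -/b -/C; congr block_mx.
    rewrite [LHS]mx11_scalar; congr (_%:M); rewrite [LHS]mxE [LHS]mxE.
    by congr (fun_of_matrix G1 _ _); apply: val_inj.
  by rewrite trmx_ursub symG1.
(* [v] is a nonzero integer multiple of the first column of [U1], so that column has no larger value
   and is itself near-minimal. *)
have a_min z : intmx z -> z != 0 -> a <= 2 * qform G1 z.
  move=> hz z0.
  have : qform G v <= 2 * qform G (U1 *m z).
    apply: vmin; first exact: intmxM.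
    by apply: contraNneq z0 => h; rewrite -[z]mul1mx -VU1 -mulmxA h mulmx0.
  rewrite -qform_mul -/G1; apply: le_trans.
  have c0 : c != 0 by apply: contraNneq v0 => c0; rewrite ev c0 scale0r.
  have qcol : qform G (col ord0 U1) = a.
    by rewrite colE -qform_mul -/G1 qform_delta.
  have q0 : 0 <= qform G (col ord0 U1).
    by case: cG => e e0 he; apply: le_trans (he _); rewrite mulr_ge0 ?sqnorm_ge0 // ltW.
  rewrite -qcol ev.
  have -> x : qform G (c *: x) = c ^+ 2 * qform G x.
    by rewrite /qform [_^T]linearZ /= -!scalemxAl -scalemxAr scalerA mxE expr2.
  rewrite ler_peMl // -[leRHS]real_normK ?num_real //.
  by rewrite exprn_ege1 // norm_intr_ge1.
have a0 : 0 < a.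
  case: cG1 => e e0 he.
  have := he (delta_mx ord0 ord0); rewrite qform_delta -/a.
  apply: lt_le_trans; rewrite mulr_gt0 // (lt_le_trans ltr01) //.
  apply: int_sqnorm_ge1; first by move=> i j; rewrite mxE natr_int.
  by apply/cV0Pn; exists ord0; rewrite mxE !eqxx oner_eq0.
(* The form of the lattice projected orthogonally to its first basis vector. *)
pose S := C - a^-1 *: (b^T *m b).
have qS x w : qform G1 (col_mx x%:M w) = a^-1 * (a * x + (b *m w) ord0 ord0) ^+ 2 + qform S w.
  by rewrite eG1 qform_block // gt_eqF.
have symS : S^T = S.
  rewrite /S linearB linearZ /= trmx_mul trmxK; congr (_ - _).
  by rewrite trmx_drsub symG1.
have cS : coercive S.
  case: cG1 => e e0 he; exists e => // w.
  have := he (col_mx (- (a^-1 * (b *m w) ord0 ord0))%:M w).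
  rewrite qS mulrN mulVKf ?gt_eqF // addNr expr0n mulr0 add0r; apply: le_trans.
  rewrite ler_pM2l // /sqnorm big_split_ord /= big_ord1 ler_wpDl ?sqr_ge0 //.
  by apply: ler_sum => i _; rewrite col_mxEd.
(* With the first coordinate rounded to the nearest integer, the square contributes at most a/4.
   Near-minimality then gives a <= 2 (a/4 + S(w)), hence the factor 4. *)
have S_min w : intmx w -> w != 0 -> a <= 4 * qform S w.
  move=> hw w0.
  have [x hx xy] := nearest_int (- (a^-1 * (b *m w) ord0 ord0)).
  have := a_min (col_mx x%:M w) _ _; rewrite qS.
  have -> : a * x + (b *m w) ord0 ord0 = a * (x - - (a^-1 * (b *m w) ord0 ord0)).
    by rewrite opprK mulrDr mulVKf ?gt_eqF.
  rewrite exprMn [a ^+ 2]expr2 !mulrA mulVf ?gt_eqF // mul1r => h.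
  have {h} : a <= 2 * (a * (x - - (a^-1 * (b *m w) ord0 ord0)) ^+ 2 + qform S w).
    rewrite expr2 [a * (_ * _)]mulrA; apply: h.
      move=> i j; rewrite -(splitK i); case: (split i) => i' /=.
        by rewrite col_mxEu !ord1 mxE eqxx mulr1n.
      by rewrite col_mxEd.
    by apply: contraNneq w0 => h; rewrite -(col_mxKd x%:M w) h linear0.
  move: xy; move: (_ ^+ 2) => y xy h.
  have : a * y <= a * 4^-1 by rewrite ler_pM2l.
  by lra.
have [U' [V' [T' [[hU' hV' UV'] eT' tT' pT' rT']]]] := IH S symS cS.
pose s := Num.sqrt a.
have s0 : 0 < s by rewrite sqrtr_gt0.
have ss : s * s = a by rewrite -expr2 sqr_sqrtr // ltW.
have h0 (k l : nat) : intmx (0 : 'M[R]_(k, l)) by move=> i j; rewrite mxE rpred0.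
exists (U1 *m block_mx 1%:M 0 0 U'), (block_mx 1%:M 0 0 V' *m V1),
  (block_mx s%:M (s^-1 *: (b *m U')) 0 T').
split.
- split; try (apply: intmxM => //; apply: intmx_block => //; exact: intmx1).
  rewrite mulmxA -[X in X *m V1]mulmxA mulmx_block.
  by rewrite !(mulmx0, mul0mx, addr0, add0r, mulmx1, mul1mx) UV' -scalar_mx_block mulmx1.
- rewrite trmx_mul !mulmxA -[_ *m G]mulmxA -[_ *m U1]mulmxA -/G1 eG1.
  rewrite !tr_block_mx !mulmx_block.
  rewrite !(trmx0, trmx1, tr_scalar_mx, mulmx0, mul0mx, addr0, add0r, mulmx1, mul1mx).
  rewrite -scalar_mxM ss !linearZ /= trmx_mul !mul_scalar_mx !mul_mx_scalar.
  rewrite !scalerA mulfV ?gt_eqF // !scale1r; congr block_mx.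
    by rewrite mulVf ?gt_eqF // scale1r.
  rewrite -scalemxAl scalerA -invfM ss -eT' /S.
  rewrite mulmxBr mulmxBl -!(scalemxAl, scalemxAr) !mulmxA.
  by rewrite addrC subrK.
- move=> i j; rewrite -(splitK i) -(splitK j).
  case: (split i) => i'; case: (split j) => j' /=; rewrite ?ord1 //=.
    by move=> _; rewrite block_mxEdl mxE.
  by rewrite ltn_add2l block_mxEdr => /tT'.
- move=> i; rewrite -(splitK i); case: (split i) => i' /=.
    by rewrite block_mxEul ord1 mxE eqxx mulr1n.
  by rewrite block_mxEdr.
- move=> i j; rewrite -(splitK i) -(splitK j).
  case: (split i) => i'; case: (split j) => j' /=; rewrite ?ord1 //=; last first.
    by rewrite !add1n => -[/rT']; rewrite !block_mxEdr.
  rewrite add1n => -[j0]; rewrite block_mxEul block_mxEdr mxE eqxx mulr1n.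
  (* The new comparison is between [s] and the first diagonal entry of [T']. Squared, it is [S_min]
     at the first column of [U'], and 4 becomes the factor 2. *)
  rewrite -(@ler_pXn2r _ 2) ?nnegrE ?mulr_ge0 ?(ltW s0) ?(ltW (pT' _)) //.
  rewrite exprMn expr2 ss.
  have -> : T' j' j' ^+ 2 = qform S (col j' U').
    rewrite colE -qform_mul eT' qform_delta mxE (bigD1 j') //= big1 ?addr0 => [|k kj].
      by rewrite !mxE expr2.
    rewrite mxE tT' ?mul0r // j0 lt0n.
    by apply: contra kj => /eqP h; apply/eqP/val_inj; rewrite /= h j0.
  rewrite (_ : 2 ^+ 2 = 4); last by ring.
  apply: S_min => [k l|]; first by rewrite mxE.
  apply/negP => /eqP h.
  have : row j' V' *m col j' U' = 0 by rewrite h mulmx0.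
  have VU' : V' *m U' = 1%:M by apply: mulmx1C.
  rewrite rowE colE -mulmxA [V' *m _]mulmxA VU' mul1mx => /matrixP /(_ ord0 ord0).
  rewrite -rowE !mxE !eqxx => /eqP; by rewrite oner_eq0.
Qed.

End Reduction.

(** * Initial segments as lowest sets of given size *)

Section InitialSegments.
Variable d : nat.

Definition init_set q : {set 'I_d} := [set i : 'I_d | (i < q)%N].

Lemma init_setS q (j : 'I_d) : j = q :> nat -> init_set q.+1 = j |: init_set q.
Proof.
by move=> jq; apply/setP => i; rewrite !inE ltnS leq_eqVlt -jq (inj_eq val_inj).
Qed.

Lemma notin_init_set q (j : 'I_d) : j = q :> nat -> j \notin init_set q.
Proof. by move=> <-; rewrite inE ltnn. Qed.

Lemma card_init_set q : (q <= d)%N -> #|init_set q| = q.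
Proof.
elim: q => [|q IH] qd; first by apply: eq_card0 => i; rewrite inE.
have ej : Ordinal qd = q :> nat by [].
by rewrite (init_setS ej) cardsU1 notin_init_set // IH // ltnW.
Qed.

(* Among the sets with q elements, the initial segment is the lowest one. *)
Lemma init_set_ind (P : nat -> {set 'I_d} -> Prop) : P 0%N set0 ->
  (forall q (j k : 'I_d) (I : {set 'I_d}), j = q :> nat -> (j <= k)%N -> k \in I ->
     P q (I :\ k) -> P q.+1 I) ->
  forall I : {set 'I_d}, P #|I| I.
Proof.
move=> P0 PS I; move: {-1}#|I| (erefl #|I|) => q; elim: q I => [|q IH] I cI.
  by move/eqP: cI; rewrite cards_eq0 => /eqP ->.
have qd : (q < d)%N by rewrite -cI -[leqRHS]card_ord max_card.
(* A set with q + 1 elements does not fit into q positions. *)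
have [k kI qk] : exists2 k, k \in I & (q <= k)%N.
  apply/exists_inP; apply: contraPT cI => /exists_inPn h.
  have /subset_leq_card : I \subset init_set q.
    by apply/subsetP => k /h; rewrite inE ltnNge.
  by rewrite card_init_set ?(ltnW qd) // => ? cI; move: cI; lia.
apply: (PS q (Ordinal qd) k) => //; apply: IH.
by move: cI; rewrite (cardsD1 k) kI => -[].
Qed.

(** Minimality of this weight makes an initial segment the only index at which a wedge of leading
    triangular columns can be nonzero. *)
Lemma set_weight_init_set (I : {set 'I_d}) : (set_weight (init_set #|I|) <= set_weight I)%N.
Proof.
apply: (init_set_ind (P := fun q I => (set_weight (init_set q) <= set_weight I)%N)) =>
  [|q j k {}I jq jk kI IH].
  by rewrite (_ : init_set 0 = set0) //; apply/setP => i; rewrite !inE.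
rewrite (set_weightD1 kI) (init_setS jq) (set_weightD1 (setU11 _ _)).
by rewrite setU1K ?notin_init_set // leq_add.
Qed.

End InitialSegments.

(** * Mahler's inequality for consecutive compound bodies *)

Section Transfer.
Variables (R : realType) (d : nat).

(** Chaining the consecutive bounds costs one factor 2 per step, and there are fewer than [d]
    steps. *)
Lemma slow_decay (g : 'I_d -> R) : (forall i, 0 < g i) ->
  (forall i j : 'I_d, j = i.+1 :> nat -> g i <= 2 * g j) ->
  forall i j : 'I_d, (i <= j)%N -> g i <= 2 ^+ d * g j.
Proof.
move=> g0 hg i j ij.
suff {ij} h k : forall j : 'I_d, j = (i + k)%N :> nat -> g i <= 2 ^+ k * g j.
  apply: (le_trans (h (j - i)%N j _)); first by rewrite subnKC.
  by rewrite ler_pM2r // ler_weXn2l ?ler1n //; have := ltn_ord j; lia.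
elim: k => [|k IH] j' ej.
  by rewrite expr0 mul1r (_ : j' = i) //; apply: val_inj; rewrite /= ej addn0.
have ltkd : (i + k < d)%N by have := ltn_ord j'; lia.
apply: (le_trans (IH (Ordinal ltkd) erefl)).
rewrite exprSr -mulrA ler_pM2l ?exprn_gt0 //; apply: hg => /=; lia.
Qed.

(** The elements of [I] can be matched with lower or equal ones of the initial segment; each pair
    costs one factor [c]. *)
Lemma prod_init_set_le (g : 'I_d -> R) (c : R) : 1 <= c -> (forall i, 0 < g i) ->
  (forall i j : 'I_d, (i <= j)%N -> g i <= c * g j) ->
  forall I : {set 'I_d}, \prod_(i in init_set d #|I|) g i <= c ^+ #|I| * \prod_(i in I) g i.
Proof.
move=> c1 g0 hg; apply: (init_set_ind (P := fun q I =>
  \prod_(i in init_set d q) g i <= c ^+ q * \prod_(i in I) g i)) => [|q j k I jq jk kI IH].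
  by rewrite !big_set0 mul1r.
rewrite (init_setS jq) (big_setU1 _ (notin_init_set jq)) /= (big_setD1 k kI) /=.
rewrite exprS mulrACA; apply: ler_pM => //; last exact: hg.
  exact: ltW.
by apply: prodr_ge0 => i _; exact: ltW.
Qed.

Lemma det_upper_triangular (T : 'M[R]_d) :
  (forall i j : 'I_d, (j < i)%N -> T i j = 0) -> \det T = \prod_i T i i.
Proof.
move=> hT; rewrite -det_tr det_trig; first by apply: eq_bigr => i _; rewrite mxE.
by apply/is_trig_mxP => i j ij; rewrite mxE hT.
Qed.

Lemma coercive_gram (A : 'M[R]_d) : A \in unitmx -> coercive (A^T *m A).
Proof.
move=> uA; rewrite -[A^T]mulmx1; apply: coercive_mul (mulVmx uA) _.
by exists 1 => // x; rewrite /qform mulmx1 mul1r sqnormE.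
Qed.

Lemma orthogonal_entry (Q : 'M[R]_d) i j : Q^T *m Q = 1%:M -> `|Q i j| <= 1.
Proof.
move/matrixP => /(_ j j); rewrite !mxE eqxx => h.
rewrite -(@expr_le1 _ 2) // real_normK ?num_real // -[leRHS]h.
rewrite (bigD1 i) //= mxE expr2 lerDl sumr_ge0 // => k _.
by rewrite mxE -expr2 sqr_ge0.
Qed.

Lemma unimodular_det (U V : 'M[R]_d) : intmx U -> intmx V -> U *m V = 1%:M ->
  `|\det U| = 1.
Proof.
have det_int (M : 'M[R]_d) : intmx M -> \det M \is a Num.int.
  move=> hM; apply: rpred_sum => s _; rewrite rpredM ?rpredX ?rpredN ?rpred1 //.
  exact: rpred_prod.
move=> hU hV /(congr1 determinant); rewrite det_mulmx det1 => e.
have := congr1 Num.norm e; rewrite normrM normr1 => ne.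
have u0 : \det U != 0 by apply: contraPneq e => ->; rewrite mul0r => /eqP; rewrite eq_sym oner_eq0.
have v0 : \det V != 0 by apply: contraPneq e => ->; rewrite mulr0 => /eqP; rewrite eq_sym oner_eq0.
have := norm_intr_ge1 (det_int _ hU) u0; have := norm_intr_ge1 (det_int _ hV) v0.
move: ne; move: (`|_|) (`|_|) => x y; nra.
Qed.

Lemma bigwedge_init_set (T : 'M[R]_d) q J :
  (forall i j : 'I_d, (j < i)%N -> T i j = 0) -> (q <= d)%N ->
  bigwedge T (init_set d q) J =
  (J == init_set d q)%:R * \prod_(i in init_set d q) T i i.
Proof.
move=> hT qd; case: eqP => [->|nJ]; first by rewrite mul1r bigwedge_triangular_diag.
rewrite mul0r; apply/eqP; apply: contraTT isT => h.
have cJ : #|J| = q.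
  apply/eqP; apply: contraNT h => cJ; rewrite bigwedge_extpower //.
  by rewrite card_init_set.
have := set_weight_init_set J; rewrite cJ.
by case: (bigwedge_triangular hT h) => // ? ?; lia.
Qed.

(* Mahler's inequality between the first minima of consecutive compound bodies. *)
Lemma compound_transfer p : (p < d)%N -> exists2 C : R, 1 <= C &
  forall (A : 'M[R]_d) (Z : multivec R d) (K : R),
  A \in unitmx -> int_extpower p Z -> Z <> 0 ->
  (forall I, `|extend A Z I| <= K) ->
  exists (Z' : multivec R d) (K' : R), [/\ int_extpower p.+1 Z', Z' <> 0, 0 < K',
    forall I, `|extend A Z' I| <= K' &
    K' ^+ (d - p) <= C * (K ^+ (d - p).-1 * `|\det A|)].
Proof.
move=> pd.
(* Orthogonal matrices have entries bounded by 1, so one constant serves [Q] and its transpose. *)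
have [C1 C11 hC1] := @extend_bound R d 1.
have C10 : 0 < C1 by apply: lt_le_trans C11.
pose c : R := 2 ^+ d.
have c1 : 1 <= c by rewrite exprn_ege1 ?ler1n.
(* The three factors come from the bound on the new vector, from [PK] and from [Pdet]. *)
exists (C1 ^+ (d - p) * ((c ^+ p * C1) ^+ (d - p).-1 * c ^+ (d - p))).
  by repeat first [exact: C11 | exact: c1 | apply: exprn_ege1 | apply: mulr_ege1].
move=> A Z K uA [Zp Zint] Z0 hK.
have symG : (A^T *m A)^T = A^T *m A by rewrite trmx_mul trmxK.
have [U [V [T [[hU hV UV] eT tT pT rT]]]] := gram_reduction symG (coercive_gram uA).
have VU : V *m U = 1%:M by apply: mulmx1C.
have detT : \det T = \prod_i T i i by apply: det_upper_triangular.
have detT0 : 0 < \det T by rewrite detT; apply: prodr_gt0.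
have uT : T \in unitmx by rewrite unitmxE unitfE gt_eqF.
have detTA : \det T = `|\det A|.
  have /(congr1 (fun x => `|x|)) := congr1 determinant eT.
  rewrite !det_mulmx !det_tr !normrM (unimodular_det hU hV UV) mul1r mulr1.
  rewrite (ger0_norm (ltW detT0)) -!expr2 => /eqP.
  by rewrite eqrXn2 // ?ltW // => /eqP.
(* The orthogonal factor: A U and T have the same Gram matrix. *)
pose Q := A *m U *m invmx T.
have QT : Q *m T = A *m U by rewrite mulmxKV.
have eA : A = Q *m (T *m V) by rewrite mulmxA QT -mulmxA UV mulmx1.
have QQ : Q^T *m Q = 1%:M.
  have BB : (A *m U)^T *m (A *m U) = T^T *m T by rewrite -eT trmx_mul !mulmxA.
  rewrite /Q trmx_mul -[LHS]mulmxA [_ *m (_ *m _ *m invmx T)]mulmxA BB !mulmxA.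
  by rewrite trmx_inv mulVmx ?unitmx_tr // mul1mx mulmxV.
have QQ' : Q *m Q^T = 1%:M by apply: mulmx1C.
have Qb i j : `|Q i j| <= 1 by apply: orthogonal_entry.
have Qtb i j : `|Q^T i j| <= 1 by rewrite mxE.
pose g i := T i i.
have hg := slow_decay pT rT.
pose P q := \prod_(i in init_set d q) g i.
have P0 q : 0 < P q by apply: prodr_gt0 => i _; exact: pT.
(* Lower bound: in the basis [U] and up to [Q], some nonzero integer coordinate of [Z] is scaled by
   a product of p diagonal entries of [T]. By slow decay the leading such product is the least up to
   [c ^+ p]. *)
have PK : P p <= c ^+ p * C1 * K.
  pose Z0' := extend V Z.
  have Z0'0 : Z0' <> 0.
    by move=> h; apply: Z0; rewrite -[Z]extend1 -UV extend_mul -/Z0' h extend0.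
  have [I ZI TI] := extend_triangular_lower Z0'0 tT.
  have cI : #|I| = p.
    by apply/eqP; apply: contraNT ZI => /(extend_extpower V Zp) ->.
  have := prod_init_set_le c1 pT hg I; rewrite cI -/(P p) => /le_trans; apply.
  rewrite -mulrA ler_pM2l ?exprn_gt0 ?(lt_le_trans ltr01 c1) //.
  have := hC1 _ Qtb _ _ hK I.
  rewrite -extend_mul eA mulmxA QQ mul1mx extend_mul TI; apply: le_trans.
  have gI : 0 < \prod_(i in I) T i i by apply: prodr_gt0.
  rewrite normrM (gtr0_norm gI) ler_peMl ?(ltW gI) //.
  by apply: norm_intr_ge1 ZI; apply: extend_int.
pose j := Ordinal pd.
have PS : P p.+1 = P p * g j.
  by rewrite /P (@init_setS _ p j) // big_setU1 ?notin_init_set //= mulrC.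
(* The last d - p diagonal entries are at least [g j / c], and their product is det T / P p. *)
have Pdet : P p * g j ^+ (d - p) <= c ^+ (d - p) * \det T.
  rewrite detT (bigID (fun i => i \in init_set d p)) /= -/(P p) mulrCA ler_pM2l //.
  have <- : #|~: init_set d p| = (d - p)%N.
    by rewrite cardsCs setCK card_ord card_init_set // ltnW.
  have -> : \prod_(i < d | i \notin init_set d p) T i i = \prod_(i in ~: init_set d p) g i.
    by apply: eq_bigl => i; rewrite !inE.
  rewrite -!prodr_const.
  rewrite -big_split /=; apply: ler_prod => i; rewrite !inE -leqNgt => pi.
  by apply/andP; split; [exact: (ltW (pT _)) | exact: hg].
(* The wedge of the first p + 1 columns of [U] is short because [T] multiplies the leading
   coordinate (p+1)-vector by [P p.+1]. *)
exists (bigwedge U (init_set d p.+1)), (C1 * P p.+1); split.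
- split=> [|I]; last exact: bigwedge_int.
  by have := @bigwedge_extpower R d U (init_set d p.+1); rewrite card_init_set.
- move=> h; have := bigwedge1E R (init_set d p.+1) (init_set d p.+1).
  by rewrite -VU bigwedge_mul h extend0 ffunE eqxx => /eqP; rewrite eq_sym oner_eq0.
- by rewrite mulr_gt0.
- move=> I; rewrite -bigwedge_mul -QT bigwedge_mul; apply: hC1 => // J.
  rewrite bigwedge_init_set // normrM -/(P _) (gtr0_norm (P0 _)).
  case: eqP => _; rewrite ?normr1 ?normr0 ?mul1r ?mul0r //; exact: ltW (P0 _).
rewrite exprMn -mulrA ler_pM2l ?exprn_gt0 // PS exprMn -detTA.
have e : (d - p)%N = (d - p).-1.+1 by lia.
(* One factor [P p] joins the power of [g j] for [Pdet]; the other d - p - 1 are bounded by [PK]. *)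
rewrite {1}e exprSr -mulrA.
rewrite mulrACA -exprMn ler_pM ?exprn_ge0 ?mulr_ge0 ?exprn_ge0 ?(ltW (P0 p)) ?(ltW (pT j)) //.
by rewrite lerXn2r ?nnegrE ?(ltW (P0 p)) // (le_trans _ PK) ?(ltW (P0 p)).
Qed.

End Transfer.

(** * Diagonal matrices on exterior powers *)

Section Diagonal.
Variables (R : realType) (d : nat).

Lemma mv_vecZ c (v : 'cV[R]_d) : mv_vec (c *: v) = c *: mv_vec v.
Proof.
apply/ffunP => I; rewrite mvZE !ffunE mulr_sumr.
by apply: eq_bigr => i _; rewrite mxE.
Qed.

Lemma bigwedge_diag (v : 'rV[R]_d) I :
  bigwedge (diag_mx v) I = (\prod_(i in I) v ord0 i) *: bigwedge 1%:M I.
Proof.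
elim/set_min_ind: I => [|j I jI IH]; first by rewrite !bigwedge0 big_set0 scale1r.
have nj : j \notin I by apply/negP => /jI; rewrite ltnn.
rewrite !bigwedgeU1 // IH big_setU1 //= wedgeZr mulrC -scalerA -[in RHS]wedgeZl -mv_vecZ.
congr (_ *: wedge (mv_vec _) _); apply/colP => i; rewrite !mxE.
by case: eqP => [->|]; rewrite ?mulr1n ?mulr1 ?mulr0n ?mulr0.
Qed.

Lemma extend_diag (v : 'rV[R]_d) X I :
  extend (diag_mx v) X I = (\prod_(i in I) v ord0 i) * X I.
Proof.
rewrite -[X in RHS]extend1 !mvsumE mulr_sumr; apply: eq_bigr => J _.
rewrite !mvZE bigwedge_diag mvZE bigwedge1E.
by case: eqP => [->|_]; rewrite ?mulr0 // !mulr1 mulrC.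
Qed.

End Diagonal.

Lemma powR_mulXn (R : realType) (t a g : R) k : 0 < t ->
  t `^ a * (t `^ g) ^+ k = t `^ (a + g * k%:R).
Proof.
move=> t0; rewrite -powR_mulrn ?powR_ge0 // -powRrM -powRD //.
by rewrite (gt_eqF t0) implybT.
Qed.

Lemma mulXn_powR (R : realType) (t g : R) k : 0 < t ->
  t * (t `^ g) ^+ k = t `^ (1 + g * k%:R).
Proof. by move=> t0; rewrite -powR_mulXn // powRr1 // ltW. Qed.

(** * The system as a norm bound in the stretched frame *)

Section System.
Variables (R : realType) (m n : nat) (Theta : 'M[R]_(n, m)).
Local Notation d := (m + n)%N.
Local Notation ell := (ell_mx Theta).
Local Notation firsts := [set lshift n i | i in 'I_m].

Lemma firstsE (i : 'I_d) : (i \in firsts) = (i < m)%N.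
Proof.
apply/imsetP/idP => [[j _ ->]|im]; first exact: ltn_ord j.
by exists (Ordinal im) => //; apply: val_inj.
Qed.

Lemma card_firsts : #|firsts| = m.
Proof. by rewrite card_imset ?card_ord //; exact: lshift_inj. Qed.

(** The matrix is the identity plus a skew-symmetric one: a kernel vector (x, y) satisfies |x|^2 =
    -|y|^2 in Euclidean norm, so it vanishes. *)
Lemma ell_unit : ell \in unitmx.
Proof.
rewrite -row_free_unit -kermx_eq0; apply/rowV0P => u /sub_kermxP.
rewrite -[u]hsubmxK mul_row_block !mulmx1 mulmxN.
set x := lsubmx u; set y := rsubmx u => /eqP.
rewrite -[X in _ == X](@row_mx0 _ _ m n) => /eqP /eq_row_mx [e1 e2].
have sq k (z : 'rV[R]_k) : 0 <= (z *m z^T) ord0 ord0 ?= iff (z == 0).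
  rewrite mxE; split; first by rewrite sumr_ge0 // => i _; rewrite mxE -expr2 sqr_ge0.
  rewrite eq_sym psumr_eq0; last by move=> i _; rewrite mxE -expr2 sqr_ge0.
  apply/allP/eqP => [h|-> i _]; last by rewrite !mxE mul0r eqxx.
  apply/rowP => i; have := h i; rewrite mem_index_enum !mxE mulf_eq0 orbb => /(_ isT) /eqP ->.
  by [].
have ey : y = x *m Theta^T by apply/eqP; rewrite -subr_eq0 addrC e2.
have ex : x = - (y *m Theta) by apply/eqP; rewrite -subr_eq0 opprK e1.
have exy : x *m x^T = - (y *m y^T).
  by rewrite {1}ex mulNmx {3}ey trmx_mul trmxK mulmxA.
have oppE (B : 'M[R]_1) : (- B) ord0 ord0 = - B ord0 ord0 by rewrite mxE.
have := sq _ x; have := sq _ y; rewrite exy oppE => -[y0 yE] [x0 xE].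
have e : (y *m y^T) ord0 ord0 = 0 by lra.
move: yE xE; rewrite e oppr0 eqxx => /esym/eqP -> /esym/eqP ->.
by rewrite row_mx0.
Qed.

Definition stretch (Y : R) : 'M[R]_d :=
  diag_mx (\row_(j < d) if (j < m)%N then 1 else Y).

(* With Y = t^(1 + gamma), the system is |/\^p(stretched_frame Y) Z| <= t Y^max(0, p - m)
   up to constants. *)
Definition stretched_frame (Y : R) : 'M[R]_d := stretch Y *m invmx ell.

Lemma extend_stretch Y X I : extend (stretch Y) X I = Y ^+ #|I :\: firsts| * X I.
Proof.
rewrite extend_diag; congr (_ * _); rewrite (bigID (fun i : 'I_d => (i < m)%N)) /=.
rewrite big1 => [|i /andP[_ im]]; last by rewrite mxE im.
rewrite mul1r (eq_bigr (fun=> Y)) => [|i /andP[_ /negbTE im]]; last by rewrite mxE im.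
rewrite -prodr_const; apply: eq_bigl => i.
by rewrite [RHS]in_setD firstsE andbC.
Qed.

Lemma det_stretch Y : \det (stretch Y) = Y ^+ n.
Proof.
rewrite det_diag big_split_ord /= big1 => [|i _]; last by rewrite mxE /= ltn_ord.
rewrite mul1r (eq_bigr (fun=> Y)) => [|i _].
  by rewrite prodr_const card_ord.
by rewrite mxE /= ltnNge leq_addr.
Qed.

Lemma stretched_frame_unit Y : 0 < Y -> stretched_frame Y \in unitmx.
Proof.
move=> Y0; rewrite unitmx_mul unitmx_inv ell_unit andbT unitmxE unitfE det_stretch.
by rewrite expf_neq0 ?gt_eqF.
Qed.

Lemma det_stretched_frame Y : 0 <= Y ->
  `|\det (stretched_frame Y)| = Y ^+ n * `|\det (invmx ell)|.
Proof. by move=> Y0; rewrite det_mulmx det_stretch normrM ger0_norm ?exprn_ge0. Qed.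

Lemma entry_bound a b (M : 'M[R]_(a, b)) : exists B, forall i j, `|M i j| <= B.
Proof.
exists (\sum_i \sum_j `|M i j|) => i j.
have h : `|M i j| <= \sum_j `|M i j| by rewrite (bigD1 j) //= lerDl sumr_ge0.
apply: (le_trans h); rewrite [leRHS](bigD1 i) //= lerDl.
by do 2!apply: sumr_ge0 => ? _.
Qed.

Lemma extend_bound1 (M : 'M[R]_d) : exists2 C : R, 1 <= C &
  forall (X : multivec R d) (K : R), (forall I, `|X I| <= K) -> forall I, `|extend M X I| <= C * K.
Proof.
have [B hB] := entry_bound M; have [C C1 hC] := @extend_bound R d B.
by exists C => //; apply: hC.
Qed.

Lemma mv_normP (X : multivec R d) K : 0 <= K ->
  mv_norm X <= K <-> forall I, `|X I| <= K.
Proof.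
move=> K0; split=> [h I|h]; first by apply: le_trans h; apply: le_bigmax.
by apply/bigmax_leP; split.
Qed.

Lemma wedge_bigL s Z J :
  wedge (bigL Theta s) Z J =
  extend ell (wedge (bigwedge 1%:M s) (extend (invmx ell) Z)) J.
Proof.
by rewrite -wedge_bigwedge_extend -extend_mul mulmxV ?ell_unit // extend1.
Qed.

(** Each coordinate of [Z] in the l-basis is read off from one inequality, the one whose sigma is
    the part of {1..m} missing from its index set. *)
Lemma solvable_frame_bound : exists2 C : R, 1 <= C &
  forall (p : nat) (gamma t : R), 0 < t -> system_solvable Theta p gamma t ->
  exists Z : multivec R d, [/\ int_extpower p Z, Z <> 0 & forall I,
    `|extend (stretched_frame (t `^ (1 + gamma))) Z I|
      <= C * (t * (t `^ (1 + gamma)) ^+ (p - m))].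
Proof.
have [C C1 hC] := extend_bound1 (invmx ell).
exists C => // p gamma t t0 [Z [[Zp Zint] Z0 hZ]]; exists Z; split => // I.
have C0 : 0 <= C by apply: le_trans C1.
rewrite extend_mul extend_stretch normrM ger0_norm ?exprn_ge0 ?powR_ge0 //.
set c := extend (invmx ell) Z.
have [cI|cI] := eqVneq #|I| p; last first.
  rewrite /c (extend_extpower _ Zp cI) normr0 mulr0 mulr_ge0 // mulr_ge0 ?(ltW t0) //.
  by rewrite exprn_ge0 ?powR_ge0.
pose s : {set 'I_d} := firsts :\: I.
have cIs : (#|I :&: firsts| + #|I :\: firsts| = p)%N by rewrite cardsID.
have cs : (#|I :&: firsts| + #|s| = m)%N by rewrite setIC cardsID card_firsts.
set tau := t `^ (1 - (#|s|%:R - (m - p)%N%:R) * (1 + gamma)).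
have htau : `|c I| <= C * tau.
  have hw J : `|wedge (bigL Theta s) Z J| <= tau.
    have sm : (#|s| <= m)%N := leq_trans (leq_addl _ _) (eq_leq cs).
    have h := hZ _ sm.
    apply: (le_trans (y := mv_norm (wedge (bigL Theta s) Z))).
      exact: le_bigmax.
    apply: le_trans h; apply: (le_bigmax_cond 0 (fun s => mv_norm (wedge (bigL Theta s) Z))).
    by rewrite inE eqxx subsetDl.
  (* The coordinate of e_s wedge c at the union of [s] and [I] is [c I] up to sign. *)
  have := hC _ _ hw (s :|: I).
  have -> : wedge (bigL Theta s) Z = extend ell (wedge (bigwedge 1%:M s) c).
    by apply/ffunP => J; rewrite wedge_bigL.
  rewrite -extend_mul mulVmx ?ell_unit // extend1 wedge_bigwedge1E subsetUl.
  have -> : (s :|: I) :\: s = I.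
    by apply/setP => i; rewrite /s !in_setD in_setU in_setD; case: (i \in I); case: (i \in _).
  by rewrite normrM normrX normrN1 expr1n mul1r.
apply: (le_trans (ler_wpM2l _ htau)); first by rewrite exprn_ge0 ?powR_ge0.
rewrite mulrCA ler_wpM2l // mulrC powR_mulXn // mulXn_powR // -/s.
(* Stretching exactly compensates the exponent of the inequality, because [I] has p elements and [s]
   completes its part in {1..m}. *)
suff -> : (p - m)%:R = #|I :\: firsts|%:R - #|s|%:R + (m - p)%:R :> R.
  by rewrite [X in t `^ X <= _](_ : _ = 1 + (1 + gamma) *
    (#|I :\: firsts|%:R - #|s|%:R + (m - p)%:R)) //; ring.
have e : ((p - m) + #|s| = #|I :\: firsts| + (m - p))%N by clear -cs cIs; lia.
by have := congr1 (fun k => k%:R : R) e; rewrite !natrD; lra.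
Qed.

(** Conversely, a coordinate that survives wedging with e_sigma has an index set disjoint from
    sigma, hence with enough elements beyond m. The exponents now compare only by an inequality,
    whence the conditions on [t] and [gamma]. *)
Lemma frame_bound_solvable : exists2 C : R, 1 <= C &
  forall (p : nat) (gamma t : R) (Z : multivec R d) (K : R), 1 <= t -> 0 <= 1 + gamma ->
  int_extpower p Z -> Z <> 0 ->
  (forall I, `|extend (stretched_frame (t `^ (1 + gamma))) Z I| <= K) ->
  C * K <= t * (t `^ (1 + gamma)) ^+ (p - m) ->
  system_solvable Theta p gamma t.
Proof.
have [C C1 hC] := extend_bound1 ell.
have C0 : 0 < C by apply: lt_le_trans C1.
exists C => // p gamma t Z K t1 g0 [Zp Zint] Z0 hK CK.
have t0 : 0 < t by apply: lt_le_trans t1.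
exists Z; split => // k km.
set tau := t `^ _.
have tau0 : 0 <= tau by exact: powR_ge0.
apply/bigmax_leP; split => // s; rewrite inE => /andP[/eqP cs sf].
apply/mv_normP => // J; rewrite wedge_bigL.
set c := extend (invmx ell) Z.
rewrite -[tau](@mulfVK _ C) ?gt_eqF // mulrC; apply: hC => {}J.
rewrite wedge_bigwedge1E; case: ifP => sJ; last by rewrite normr0 divr_ge0 // ltW.
rewrite normrM normrX normrN1 expr1n mul1r; set r := J :\: s.
have [cr|cr] := eqVneq #|r| p; last first.
  by rewrite /c (extend_extpower _ Zp cr) normr0 divr_ge0 // ltW.
have cIs : (#|r :&: firsts| + #|r :\: firsts| = p)%N by rewrite cardsID.
have crs : (#|r :&: firsts| + k <= m)%N.
  rewrite -cs -cardsUI [X in (_ + X)%N](_ : _ = 0)%N ?addn0.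
    rewrite -[leqRHS]card_firsts subset_leq_card // subUset sf andbT.
    exact: subsetIr.
  by apply: eq_card0 => i; rewrite in_setI in_setI in_setD; case: (i \in s); rewrite ?andbF.
have := hK r; rewrite extend_mul extend_stretch normrM ger0_norm ?exprn_ge0 ?powR_ge0 //.
rewrite -/c => h.
have Y0 : 0 < t `^ (1 + gamma) by rewrite powR_gt0.
rewrite ler_pdivlMr // -(@ler_pM2l _ ((t `^ (1 + gamma)) ^+ #|r :\: firsts|)) ?exprn_gt0 //.
rewrite mulrA mulrC; apply: (le_trans (ler_wpM2l (ltW C0) h)); apply: (le_trans CK).
rewrite [leRHS]mulrC powR_mulXn // mulXn_powR //.
apply: ler_powR => //.
have e : ((p - m) + k <= #|r :\: firsts| + (m - p))%N by clear -crs cIs; lia.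
have : ((p - m)%:R + k%:R <= #|r :\: firsts|%:R + (m - p)%:R :> R).
  by rewrite -!natrD ler_nat.
set x := (p - m)%:R; set y : R := k%:R; set z := #|_|%:R; set w := (m - p)%:R => hxy.
have -> : 1 - (y - w) * (1 + gamma) + (1 + gamma) * z =
   1 + (1 + gamma) * (z + w - y) by ring.
by rewrite lerD2l ler_wpM2l //; lra.
Qed.

(** Here [g] and [g'] are the two values of 1 + gamma. The new parameter t' = t^(g/g') gives t'^g' =
    t^g, so both systems share the same Y and the same frame; the strict hypothesis leaves a
    positive power of t to absorb constants. *)
Lemma solvable_transfer p (g g' : R) : (p < d)%N -> 0 < g -> 0 < g' ->
  g' * ((d - p).-1%:R
    + g * (n%:R + (d - p).-1%:R * (p - m)%:R - (d - p)%:R * (p.+1 - m)%:R))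
  < g * (d - p)%:R ->
  exists T : R, forall t, T < t -> system_solvable Theta p (g - 1) t ->
    system_solvable Theta p.+1 (g' - 1) (t `^ (g / g')).
Proof.
move=> pd g0 g'0; set q := (d - p)%N; set w := (p - m)%N; set w' := (p.+1 - m)%N.
have q0 : (0 < q)%N by rewrite subn_gt0.
move=> hgg'.
have [C1 C11 h1] := solvable_frame_bound.
have [C2 C21 h2] := @compound_transfer R d p pd.
have [C3 C31 h3] := frame_bound_solvable.
have [C10 [C20 C30]] : 0 < C1 /\ 0 < C2 /\ 0 < C3 by rewrite !(lt_le_trans ltr01).
set c0 := `|\det (invmx ell)|.
pose C4 := C3 ^+ q * (C2 * (C1 ^+ q.-1 * c0)).
have C40 : 0 <= C4 by rewrite !mulr_ge0 ?exprn_ge0 ?normr_ge0 ?ltW.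
(* The exponent of t in the quotient of (t' Y^w')^q by (t Y^w)^(q-1) Y^n; its positivity is the
   hypothesis divided by [g']. *)
pose delta := (g / g' + g * w'%:R) * q%:R - ((1 + g * w%:R) * q.-1%:R + g * n%:R).
have delta0 : 0 < delta.
  have -> : delta = (g * q%:R - g' * (q.-1%:R + g *
    (n%:R + q.-1%:R * w%:R - q%:R * w'%:R))) / g'.
    by rewrite /delta; field; rewrite gt_eqF.
  by rewrite divr_gt0 // subr_gt0.
(* Beyond this threshold t^delta exceeds all the constants collected in [C4]. *)
exists (Num.max 1 (C4 `^ delta^-1)) => t; rewrite gt_max => /andP[t1 tC].
have t0 : 0 < t by apply: lt_trans t1.
have C4t : C4 <= t `^ delta.
  rewrite -[C4]powRr1 // -(@mulVf _ delta) ?gt_eqF // powRrM.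
  by apply: ge0_ler_powR; rewrite ?nnegrE ?powR_ge0 ?(ltW delta0) ?(ltW t0) ?(ltW tC).
have subK1 (x : R) : 1 + (x - 1) = x by ring.
move=> /(h1 _ _ _ t0) [Z [Zint Z0]]; rewrite subK1 => hZ.
have Y0 : 0 < t `^ g by rewrite powR_gt0.
have [Z' [K' [Z'int Z'0 K'0 hK' K'q]]] := h2 _ _ _ (stretched_frame_unit Y0) Zint Z0 hZ.
have t'1 : 1 <= t `^ (g / g').
  by rewrite -[leLHS](powRr0 t) ler_powR ?divr_ge0 ?ltW.
have t'0 : 0 < t `^ (g / g') by apply: lt_le_trans t'1.
have t'g : (t `^ (g / g')) `^ g' = t `^ g by rewrite -powRrM divfK ?gt_eqF.
have := h3 p.+1 (g' - 1) (t `^ (g / g')) Z' K' t'1.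
rewrite subK1 t'g => /(_ (ltW g'0) Z'int Z'0 hK'); apply.
rewrite powR_mulXn // -(@ler_pXn2r _ q) ?nnegrE ?mulr_ge0 ?powR_ge0 ?(ltW C30) ?(ltW K'0) //.
rewrite exprMn; apply: (le_trans (ler_wpM2l _ K'q)); first by rewrite exprn_ge0 ?ltW.
rewrite det_stretched_frame ?(ltW Y0) // mulXn_powR // exprMn -/q -/w.
have -> : C3 ^+ q * (C2 * (C1 ^+ q.-1 * (t `^ (1 + g * w%:R)) ^+ q.-1 * ((t `^ g) ^+ n * c0)))
  = C4 * ((t `^ (1 + g * w%:R)) ^+ q.-1 * (t `^ g) ^+ n).
  by rewrite /C4; ring.
have -> : (t `^ (1 + g * w%:R)) ^+ q.-1 * (t `^ g) ^+ n
   = t `^ ((1 + g * w%:R) * q.-1%:R + g * n%:R).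
  by rewrite -[RHS]powR_mulXn // [in RHS]powRrM powR_mulrn ?powR_ge0.
apply: (le_trans (ler_wpM2r (powR_ge0 _ _) C4t)).
rewrite -powRD ?(gt_eqF t0) ?implybT // subrK.
by rewrite powRrM powR_mulrn ?powR_ge0.
Qed.

(** At gamma = -1 the frame is fixed, with Y = 1, so a single integer p-vector works for all large
    [t]. Hence neither exponent is below -1. *)
Lemma solvable_trivial p : (p <= d)%N ->
  exists T : R, forall t, T < t -> system_solvable Theta p (-1) t.
Proof.
move=> pd; have [C C1 hC] := frame_bound_solvable.
pose Z : multivec R d := bigwedge 1%:M (init_set d p).
have [B hB] : exists B, forall I, `|extend (stretched_frame 1) Z I| <= B.
  exists (\sum_I `|extend (stretched_frame 1) Z I|) => I.
  by rewrite (bigD1 I) //= lerDl sumr_ge0.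
exists (Num.max 1 (C * B)) => t; rewrite gt_max => /andP[t1 tC].
have Y1 : t `^ (1 + -1) = 1 by rewrite subrr powRr0.
apply: (hC _ _ _ Z B); rewrite ?Y1 ?subrr ?expr1n ?mulr1 // ?ltW //.
- split=> [|I]; last by apply: bigwedge_int; apply: intmx1.
  by have := @bigwedge_extpower R d 1%:M (init_set d p); rewrite card_init_set.
- move=> h; have := bigwedge1E R (init_set d p) (init_set d p).
  by rewrite -/Z h ffunE eqxx => /eqP; rewrite eq_sym oner_eq0.
Qed.

End System.

(** * From the transfer of admissible values to suprema in the extended reals *)

Section Exponents.
Variable R : realType.
Implicit Types (S : set R) (q e : R).

Definition exponent_sup S : \bar R := ereal_sup [set x%:E | x in S]%classic.

Lemma exponent_sup_ge S x : S x -> (x%:E <= exponent_sup S)%E.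
Proof. by move=> Sx; apply: ereal_sup_ubound; exists x. Qed.

Lemma exponent_sup_le S (M : R) : (forall x, S x -> x <= M) ->
  (exponent_sup S <= M%:E)%E.
Proof. by move=> h; apply: ge_ereal_sup => _ [x Sx <-]; rewrite lee_fin h. Qed.

(** Membership of -1 excludes the value -oo, so a supremum needs only two cases. *)
Variant exponent_spec S : \bar R -> Prop :=
| ExponentFin r of -1 <= r & (forall x, S x -> x <= r) : exponent_spec S r%:E
| ExponentPinfty : exponent_spec S +oo%E.

Lemma exponent_supP S : S (-1) -> exponent_spec S (exponent_sup S).
Proof.
move=> /exponent_sup_ge; have := @exponent_sup_ge S.
case: (exponent_sup S) => [r| |] h; rewrite ?lee_fin //; last by constructor.
by move=> r1; constructor => // x Sx; rewrite -lee_fin h.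
Qed.

(** Here [q] stands for d - p and [e] for the power of Y that is lost. *)
Definition exponent_transfer q e S S' := forall g g', 0 < g -> 0 < g' ->
  g' * ((q - 1) + g * e) < g * q -> S (g - 1) -> S' (g' - 1).

(** Otherwise a [g'] strictly between 1 + r and g q / D would put g' - 1 into [S'], above its bound
    r. *)
Lemma exponent_transfer_le q e S S' r : 1 < q -> 0 <= e -> -1 <= r ->
  exponent_transfer q e S S' -> (forall x, S' x -> x <= r) ->
  forall g, 0 < g -> S (g - 1) -> g * q <= (1 + r) * ((q - 1) + g * e).
Proof.
move=> q1 e0 r1 tr hr g g0 Sg; rewrite leNgt; apply/negP => h.
set D := (q - 1) + g * e in h *.
have D0 : 0 < D by rewrite ltr_wpDr ?subr_gt0 // mulr_ge0 // ltW.
pose g' := ((1 + r) + g * q / D) / 2.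
have rg : 1 + r < g * q / D by rewrite ltr_pdivlMr.
have [g1 g2] : 1 + r < g' /\ g' < g * q / D by rewrite /g'; split; lra.
have : S' (g' - 1).
  apply: (tr g) => //; first by apply: le_lt_trans g1; lra.
  by rewrite -ltr_pdivlMr.
by move/hr; lra.
Qed.

Lemma exponent_mul_le q S S' : 1 < q -> S (-1) -> S' (-1) ->
  exponent_transfer q 0 S S' ->
  ((q - 1)%:E * (1 + exponent_sup S') >= q%:E * (1 + exponent_sup S))%E.
Proof.
move=> q1 S1 S'1 tr; have := @exponent_transfer_le q 0 S S' _ q1 (lexx 0) _ tr.
have q10 : 0 < q - 1 by rewrite subr_gt0.
case: (exponent_supP S'1) => [r' r'1 hr'|_]; last first.
  by rewrite addey // gt0_muley ?lte_fin // leey.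
move=> /(_ r' r'1 hr') h.
have hS x : S x -> x <= (1 + r') * (q - 1) / q - 1.
  move=> Sx; rewrite lerBrDl ler_pdivlMr; last lra.
  have [x1|x1] := ltP 0 (1 + x).
    have := h (1 + x) x1; rewrite mulr0 addr0; apply.
    by rewrite (_ : 1 + x - 1 = x) //; ring.
  apply: (@le_trans _ _ 0); first by rewrite mulr_le0_ge0 //; lra.
  by rewrite mulr_ge0 //; lra.
have := exponent_sup_le hS; case: (exponent_supP S1) => [r r1 hr|] //.
rewrite lee_fin -!EFinD -!EFinM lee_fin lerBrDl ler_pdivlMr; last lra.
by rewrite mulrC [leRHS]mulrC.
Qed.

(** Inverses in the extended reals follow 1/0 = +oo and 1/+oo = 0, which settles the degenerate
    cases; otherwise the bound of [exponent_transfer_le] is divided by g (1 + r'). *)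
Lemma exponent_inv_le q e S S' : 1 < q -> 0 < e -> S (-1) -> S' (-1) ->
  exponent_transfer q e S S' ->
  ((q - 1)%:E * (1 + exponent_sup S)^-1
     >= q%:E * (1 + exponent_sup S')^-1 - e%:E)%E.
Proof.
move=> q1 e0 S1 S'1 tr.
have q10 : 0 < q - 1 by rewrite subr_gt0.
have := @exponent_transfer_le q e S S' _ q1 (ltW e0) _ tr.
have lhs0 : (0 <= (q - 1)%:E * (1 + exponent_sup S)^-1)%E.
  apply: mule_ge0; first by rewrite lee_fin ltW.
  rewrite inve_ge0; case: (exponent_supP S1) => [r r1 _|]; last by rewrite addey.
  by rewrite -EFinD lee_fin; lra.
case: (exponent_supP S'1) => [r' r'1 hr'|_]; last first.
  rewrite addey // invey mule0 add0e; apply: le_trans lhs0.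
  by rewrite -EFinN lee_fin; lra.
move=> /(_ r' r'1 hr') h.
have key g : 0 < g -> S (g - 1) -> 0 < 1 + r' /\ q / (1 + r') - e <= (q - 1) / g.
  move=> g0 Sg; have := h g g0 Sg => {}h.
  have D0 : 0 < (q - 1) + g * e by rewrite addr_gt0 ?mulr_gt0.
  have r0 : 0 < 1 + r'.
    rewrite -(pmulr_lgt0 _ D0); apply: lt_le_trans h.
    by rewrite mulr_gt0 //; lra.
  split => //; rewrite lerBlDr ler_pdivrMr //.
  have -> : (q - 1) / g + e = ((q - 1) + g * e) / g.
    by rewrite [RHS]mulrDl [g * e]mulrC mulfK ?gt_eqF.
  by rewrite mulrAC ler_pdivlMr // mulrC [leRHS]mulrC.
(* When 1 + r' = 0, [key] leaves no element of [S] above -1, so the left side is +oo. *)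
have [r0|r0] := ltP 0 (1 + r'); last first.
  have hS x : S x -> x <= -1.
    move=> Sx; rewrite leNgt; apply/negP => x1.
    have /key : 0 < 1 + x by lra.
    rewrite (_ : 1 + x - 1 = x); last by ring.
    by move=> /(_ Sx) []; lra.
  have := exponent_sup_le hS; case: (exponent_supP S1) => [r r1 hr|] //.
  rewrite lee_fin => r1'; have -> : r = -1 by lra.
  have -> : (1 + (-1)%:E = 0 :> \bar R)%E by rewrite -EFinD subrr.
  by rewrite inve0 gt0_muley ?lte_fin // leey.
rewrite -EFinD inver (gt_eqF r0) -EFinM -EFinN -EFinD.
(* A nonpositive right side is trivial; otherwise [key] can be inverted into an upper bound for
   [S]. *)
have [le0|gt0] := leP (q / (1 + r') - e) 0.
  by apply: le_trans lhs0; rewrite lee_fin.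
set G := q / (1 + r') - e in gt0 key *.
have hS x : S x -> x <= (q - 1) / G - 1.
  move=> Sx; rewrite lerBrDl.
  have [x1|x1] := ltP 0 (1 + x).
    have [] := key (1 + x) x1; first by rewrite (_ : 1 + x - 1 = x) //; ring.
    by rewrite ler_pdivlMr // ler_pdivlMr // mulrC.
  by apply: (le_trans x1); rewrite divr_ge0 // ltW.
have := exponent_sup_le hS; case: (exponent_supP S1) => [r r1 hr|] //.
rewrite lee_fin => rG; rewrite -EFinD inver; case: eqP => [_|/eqP nz].
  by rewrite gt0_muley ?lte_fin // leey.
have r1' : 0 < 1 + r by rewrite lt_neqAle eq_sym nz; lra.
rewrite -EFinM lee_fin ler_pdivlMr // mulrC -ler_pdivlMr //; lra.
Qed.

End Exponents.

(** * Regular and uniform exponents in consecutive degrees *)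

Section Sets.
Variables (R : realType) (m n : nat) (Theta : 'M[R]_(n, m)).
Local Notation d := (m + n)%N.

Definition regular_set p : set R := [set gamma : R | forall T : R,
  exists2 t : R, T < t & system_solvable Theta p gamma t]%classic.

Definition uniform_set p : set R := [set gamma : R | \forall t \near +oo,
  system_solvable Theta p gamma t]%classic.

Lemma regular_set_trivial p : (p <= d)%N -> regular_set p (-1).
Proof.
move=> pd T; have [T0 hT0] := solvable_trivial Theta pd.
have : Num.max T T0 < Num.max T T0 + 1 by rewrite ltrDl.
by rewrite gt_max => /andP[TM /hT0 sol]; exists (Num.max T T0 + 1).
Qed.

Lemma uniform_set_trivial p : (p <= d)%N -> uniform_set p (-1).
Proof.
move=> pd; have [T0 hT0] := solvable_trivial Theta pd.
by exists T0; split; first exact: num_real.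
Qed.

(* The power of Y lost when Mahler's inequality is applied to the bounds
   t Y^max(0, p - m) and t' Y^max(0, p + 1 - m). *)
Definition exponent_defect p : R :=
  n%:R + (d - p).-1%:R * (p - m)%:R - (d - p)%:R * (p.+1 - m)%:R.

Lemma solvable_transfer_defect p (g g' : R) : (p < d)%N -> 0 < g -> 0 < g' ->
  g' * (((d - p)%:R - 1) + g * exponent_defect p) < g * (d - p)%:R ->
  exists T : R, forall t, T < t -> system_solvable Theta p (g - 1) t ->
    system_solvable Theta p.+1 (g' - 1) (t `^ (g / g')).
Proof.
move=> pd g0 g'0 hg; apply: solvable_transfer => //; move: hg; congr (_ * (_ + _) < _).
by rewrite -[in LHS](prednK (_ : 0 < d - p)%N) ?subn_gt0 // -natr1 addrK.
Qed.

(** Since t^(g/g') is increasing and unbounded in t, arbitrarily large solvable parameters stay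
    arbitrarily large. *)
Lemma regular_transfer p : (p < d)%N ->
  exponent_transfer (d - p)%:R (exponent_defect p) (regular_set p) (regular_set p.+1).
Proof.
move=> pd g g' g0 g'0 hg reg T.
have [T0 hT0] := solvable_transfer_defect pd g0 g'0 hg.
(* The maximum with 1 keeps the base of the powers positive even when [T] is not. *)
have [t] := reg (Num.max T0 (Num.max 1 T `^ (g' / g))).
rewrite gt_max => /andP[tT0 tT] /(hT0 _ tT0) sol.
exists (t `^ (g / g')) => //.
have M0 : 0 <= Num.max 1 T by rewrite le_max ler01.
apply: (@le_lt_trans _ _ (Num.max 1 T)); first by rewrite le_max lexx orbT.
have e : (g' / g) * (g / g') = 1 by rewrite mulrA divfK ?gt_eqF // mulfV ?gt_eqF.
have <- : (Num.max 1 T `^ (g' / g)) `^ (g / g') = Num.max 1 T.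
  by rewrite -powRrM e powRr1.
by apply: gt0_ltr_powR; rewrite ?divr_gt0 // nnegrE ?powR_ge0 // (le_trans _ (ltW tT)) ?powR_ge0.
Qed.

(** Every large s is t^(g/g') for the large parameter t = s^(g'/g). *)
Lemma uniform_transfer p : (p < d)%N ->
  exponent_transfer (d - p)%:R (exponent_defect p) (uniform_set p) (uniform_set p.+1).
Proof.
move=> pd g g' g0 g'0 hg [T1 [_ uni]].
have [T0 hT0] := solvable_transfer_defect pd g0 g'0 hg.
pose M := Num.max 0 (Num.max T0 T1).
have M0 : 0 <= M by rewrite le_max lexx.
exists (M `^ (g / g')); split; first exact: num_real.
move=> s Ms; have s0 : 0 <= s by apply: le_trans (powR_ge0 _ _) (ltW Ms).
have e : (g' / g) * (g / g') = 1 by rewrite mulrA divfK ?gt_eqF // mulfV ?gt_eqF.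
have : M < s `^ (g' / g).
  have <- : (M `^ (g / g')) `^ (g' / g) = M by rewrite -powRrM mulrC e powRr1.
  by apply: gt0_ltr_powR; rewrite ?divr_gt0 ?nnegrE ?powR_ge0.
rewrite !gt_max => /and3P[_ h0 h1].
have := hT0 _ h0 (uni _ h1); rewrite -powRrM e powRr1 //.
Qed.

(** With a = p - m and b = d - p - 1 one has n = a + b + 1, and n + b a - (b + 1)(a + 1)
    vanishes. *)
Lemma exponent_defect_ge p : (m <= p < d)%N -> exponent_defect p = 0.
Proof.
move=> /andP[mp pd]; rewrite /exponent_defect.
pose a := (p - m)%N; pose b := (d - p).-1.
have -> : (d - p = b.+1)%N by rewrite /b; lia.
have -> : (p.+1 - m = a.+1)%N by rewrite /a; lia.
have -> : n%:R = (a + b.+1)%:R :> R by congr (_%:R); rewrite /a /b; lia.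
by rewrite natrD -/a -[a.+1%:R]natr1 -[b.+1%:R]natr1; ring.
Qed.

Lemma exponent_defect_lt p : (p < m)%N -> exponent_defect p = n%:R.
Proof.
move=> pm; rewrite /exponent_defect.
have -> : (p - m = 0)%N by lia.
have -> : (p.+1 - m = 0)%N by lia.
by rewrite !mulr0 addr0 subr0.
Qed.

End Sets.

Theorem theorem1 (R : realType) (m n : nat) (hm : (1 <= m)%N) (hn : (1 <= n)%N)
    (hd : (3 <= m + n)%N) (Theta : 'M[R]_(n, m))
    (p : nat) (hp : (1 <= p <= m + n - 2)%N) :
  let d := (m + n)%N in
  let b := regular_exponent Theta in
  let a := uniform_exponent Theta in
  ((m <= p)%N ->
     ((d - p - 1)%N%:R%:E * (1 + b p.+1) >= (d - p)%N%:R%:E * (1 + b p))%E /\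
     ((d - p - 1)%N%:R%:E * (1 + a p.+1) >= (d - p)%N%:R%:E * (1 + a p))%E)
  /\
  ((p <= m - 1)%N ->
     ((d - p - 1)%N%:R%:E * (1 + b p)^-1
        >= (d - p)%N%:R%:E * (1 + b p.+1)^-1 - n%:R%:E)%E /\
     ((d - p - 1)%N%:R%:E * (1 + a p)^-1
        >= (d - p)%N%:R%:E * (1 + a p.+1)^-1 - n%:R%:E)%E).
Proof.
move=> d b a; have [p1 p2] := andP hp.
have pd : (p < m + n)%N by lia.
(* Strictness comes from p <= d - 2. *)
have q1 : 1 < (d - p)%:R :> R by rewrite ltr1n /d; lia.
have -> : (d - p - 1)%:R = (d - p)%:R - 1 :> R by rewrite natrB // subn_gt0.
have reg := @regular_transfer R m n Theta p pd; have uni := @uniform_transfer R m n Theta p pd.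
split=> [mp|pm].
  move: reg uni; rewrite exponent_defect_ge ?mp // => reg uni.
  split; apply: exponent_mul_le => //;
    (apply: regular_set_trivial || apply: uniform_set_trivial) => //; exact: ltnW.
have {}pm : (p < m)%N by lia.
move: reg uni; rewrite exponent_defect_lt // => reg uni.
split; apply: exponent_inv_le; rewrite ?ltr0n //;
  (apply: regular_set_trivial || apply: uniform_set_trivial) => //; exact: ltnW.
Qed.
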